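(* Let $P$ be a parity. For all $m\in\mathbb{N}\cup\{\infty\}$ and $t\in\mathbb{N}$, the group $\vec{\mathscr{E}}_t[m]$ is isomorphic to the Polyak group $\vec{\mathscr{P}}_t$. Moreover, the sequence $0\to\vec{\mathscr{E}}_t[m]\to\vec{\mathscr{X}}_t[m]$, whose map is induced by the inclusion of diagrams, is exact. Moreover, for every $v\in\mathrm{Hom}_{\mathbb{Z}}(\vec{\mathscr{X}}_t[m],\mathbb{Q})$, the value of $v\circ I[m]\circ\Lambda[m]$ on any classical diagram (a Gauss diagram of a classical knot diagram) is determined by the restriction of $v$ to the subgroup $\vec{\mathscr{E}}_t[m]$.
   Context: Gauss diagrams. A Gauss diagram is a fixed base (the oriented line $\mathbb{R}$ or the oriented circle $S^1$) with finitely many arrows, each with a sign $\oplus$ or $\ominus$, all endpoints distinct, up to orientation-preserving homeomorphism. $\mathscr{D}$ is the set of Gauss diagrams; $C(D)$ is the set of arrows of $D$. An arrow is isolated if its endpoints are consecutive. Reidemeister moves: $\Omega 1$ adds/removes an isolated arrow; $\Omega 2$ adds/removes two arrows of opposite sign whose tails are adjacent and whose heads are adjacent; $\Omega 3$: given three disjoint intervals $1,2,3$ of the base (in any order) and three arrows of equal sign, $1\to2$, $1\to3$, $2\to3$, whose endpoints occur on interval 1 in the order $(12),(13)$, on interval 2 in the order $(12),(23)$, on interval 3 in the order $(13),(23)$ (no other endpoints on these intervals), the move reverses the order of the two endpoints on each of the three intervals (and the inverse move). Parity. A parity $P$ labels every arrow of every Gauss diagram by $0$ (even) or $1$ (odd)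 such that: isolated arrows get $0$; two arrows involved in an $\Omega 2$ move get the same label; in an $\Omega 3$ move either zero or two of the three arrows get label $1$, and corresponding arrows on both sides get the same label; arrows not involved in a Reidemeister move keep their labels. $f(D)$ is obtained from $D$ by deleting all odd arrows. With $\infty+1=\infty$, the $f^m$-label of $x\in C(D)$ is the least $i$, $1\le i\le m$, with $x\notin C(f^i(D))$, and $m+1$ if no such $i$ exists. Groups. $\vec{\mathscr{A}}[m]$ is the set of (dashed) signed arrow diagrams, i.e. Gauss diagrams each of whose arrows carries an arbitrary label in $\{1,\dots,m+1\}$ (in $\{1,2,\dots\}\cup\{\infty\}$ if $m=\infty$). Relations: $\vec{\mathrm{Q1}}[m]$: $D=0$ if $D$ has an isolated arrow labelled $m+1$. $\vec{\mathrm{Q2}}[m]$: $D+(D\setminus a)+(D\setminus b)=0$ if $a,b$ have opposite signs, equal labels, adjacent tails and adjacent heads. $\vec{\mathrm{Q3}}[m]$: if $D,D'$ are related by an $\Omega 3$ move with corresponding arrows $a,b,c$ of equal sign having the same labels $i,j,k$ in $D$ and $D'$, where $i>j=k$, or $j>i=k$, or $k>i=j$, or $i=j=k=m+1$, then $D+(D\setminus a)+(D\setminus b)+(D\setminus c)=D'+(D'\setminus a)+(D'\setminus b)+(D'\setminus c)$. $\vec{A}_t[m]$: diagrams with more than $t$ arrows. $\vec{\mathscr{X}}_t[m]=\mathbb{Z}[\vec{\mathscr{A}}[m]]/\langle\vec{\mathrm{Q1}}[m],\vec{\mathrm{Q2}}[m],\vec{\mathrm{Q3}}[m],\vec{A}_t[m]\rangle$.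 $\vec{E}[m]\subset\vec{\mathscr{A}}[m]$ is the set of diagrams all of whose arrows are labelled $m+1$; $\vec{E}_t[m]$ is the set of those with more than $t$ arrows; $\vec{\mathrm{V}i}[m]$ ($i=1,2,3$) are the relations $\vec{\mathrm{Q}i}[m]$ in which all arrows are labelled $m+1$; $\vec{\mathscr{E}}_t[m]=\mathbb{Z}[\vec{E}[m]]/\langle\vec{E}_t[m],\vec{\mathrm{V1}}[m],\vec{\mathrm{V2}}[m],\vec{\mathrm{V3}}[m]\rangle$. The Polyak group $\vec{\mathscr{P}}_t$ is the quotient of the free abelian group on unlabelled (dashed) signed arrow diagrams by: diagrams with more than $t$ arrows; $D=0$ if $D$ has an isolated arrow; $D+(D\setminus a)+(D\setminus b)=0$ if $a,b$ have opposite signs, adjacent tails, adjacent heads; and the same eight-term relation as $\vec{\mathrm{Q3}}[m]$ without labels. Maps. $\Lambda[m]:\mathbb{Z}[\mathscr{D}]\to\mathbb{Z}[\vec{\mathscr{A}}[m]]$ sends $D$ to $D$ with its $f^m$-labelling. $I[m](D)=\sum_{F\subseteq D}F$, the sum over all subdiagrams (subsets of arrows, keeping signs and labels). $v$ is regarded as a map on $\mathbb{Z}[\vec{\mathscr{A}}[m]]$ via the quotient map. *)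

(* Defs.v *)
From HB Require Import structures.
From mathcomp Require Import all_boot all_order all_algebra.
From mathcomp Require Import generic_quotient ring_quotient boolp reals.
From mathcomp.multinomials Require Import freeg.

Set Implicit Arguments.
Unset Strict Implicit.
Unset Printing Implicit Defensive.

Import GRing.Theory Num.Theory.
Local Open Scope quotient_scope.
Local Open Scope ring_scope.

Inductive base := Line | Circle.

(* Extended naturals: [None] stands for infinity. *)
Definition enat := option nat.
Definition ele (i j : enat) : bool :=
  match i, j with
  | _, None => true
  | None, Some _ => false
  | Some i, Some j => (i <= j)%N
  end.
Definition elt (i j : enat) : bool := ~~ ele j i.
Definition esucc (m : enat) : enat := omap succn m.

(* A Gauss diagram is represented by its Gauss word: the sequence of arrow
   endpoints met along the base, the circle being cut open at a point which is
   not an endpoint. An arrow is a name, a sign ([true] is the positive one) and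
   a label in [L]; unlabelled diagrams have [L := unit]. Names only serve to
   tell arrows apart. *)
Section GaussWords.
Variable L : choiceType.

Definition arrow : Type := ((nat * bool) * L)%type.
HB.instance Definition _ := Choice.on arrow.
Definition sgn (a : arrow) : bool := a.1.2.
Definition lab (a : arrow) : L := a.2.

(* [(a, false)] is the tail of [a] and [(a, true)] its head. *)
Definition endpoint : Type := (arrow * bool)%type.
HB.instance Definition _ := Choice.on endpoint.

Definition gauss_word (w : seq endpoint) : bool :=
  uniq w && all (fun x => (x.1, ~~ x.2) \in w) w.

Record gauss := Gauss { gword :> seq endpoint; _ : gauss_word gword }.
HB.instance Definition _ := [isSub for gword].
HB.instance Definition _ := [Choice of gauss by <:].

Definition arrows (D : gauss) : seq arrow := [seq x.1 | x <- D & ~~ x.2].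

Lemma gkeep_subproof (S : pred arrow) (D : gauss) :
  gauss_word [seq x <- gword D | S x.1].
Proof.
case: D => w /= /andP[Uw /allP Aw]; rewrite /gauss_word filter_uniq //=.
by apply/allP => x; rewrite !mem_filter /= => /andP[-> /Aw].
Qed.
Definition gkeep (S : pred arrow) (D : gauss) : gauss :=
  Gauss (gkeep_subproof S D).
Definition gdel (D : gauss) (a : arrow) : gauss := gkeep (predC1 a) D.

Definition mape (g : arrow -> arrow) (x : endpoint) : endpoint := (g x.1, x.2).

(* [g] renames the arrows of [D] into those of [D'], respecting signs, labels
   and the (cyclic, for the circle) order of the endpoints. *)
Definition giso_by (b : base) (g : arrow -> arrow) (D D' : gauss) : Prop :=
  [/\ {in arrows D &, injective g},
      {in arrows D, forall a, sgn (g a) = sgn a /\ lab (g a) = lab a} &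
      exists2 k : nat, (b = Line -> k = 0%N) &
        gword D' = rot k (map (mape g) D)].

Definition giso (b : base) (D D' : gauss) : bool :=
  `[< exists g, giso_by b g D D' >].

Lemma mem_arrows (D : gauss) (x : endpoint) : x \in gword D -> x.1 \in arrows D.
Proof.
case: D x => w wP [a e]; rewrite /arrows /= => aw.
have /andP[_ /allP Aw] := wP; apply/mapP.
exists (a, false) => //; rewrite mem_filter /=.
by case: e aw => // /Aw.
Qed.

Lemma arrows_mem (D : gauss) (a : arrow) e : a \in arrows D -> (a, e) \in gword D.
Proof.
case: D => w wP; rewrite /arrows /= => /mapP[[a' e']].
have /andP[_ /allP Aw] := wP; rewrite mem_filter /= => /andP[e'F aw] ->.
by case: e' e'F aw => //; case: e => // _ /Aw.
Qed.

Lemma giso_refl b : reflexive (giso b).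
Proof.
move=> D; apply/asboolP; exists id; split=> //.
exists 0%N => //; rewrite rot0 -[LHS]map_id; apply: eq_map => -[a e] //.
Qed.

Lemma giso_trans b : transitive (giso b).
Proof.
move=> D2 D1 D3 /asboolP[g [gi gs [k kb D2E]]] /asboolP[h [hi hs [l lb D3E]]].
have gD a : a \in arrows D1 -> g a \in arrows D2.
  move=> aD; have := @mem_arrows D2 (g a, false); apply.
  by rewrite D2E mem_rot; apply/mapP; exists (a, false) => //; apply: arrows_mem.
apply/asboolP; exists (h \o g); split.
- by move=> x y xD yD /= /hi E; apply: gi => //; apply: E; apply: gD.
- move=> a aD /=; have [<- <-] := gs _ aD; exact: (hs _ (gD _ aD)).
have mE : map (mape (h \o g)) D1 = map (mape h) (map (mape g) D1).
  by rewrite -map_comp.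
rewrite mE D3E D2E map_rot.
case: b kb lb {D2E D3E} => kb lb; first by exists 0%N; rewrite // kb // lb // !rot0.
set w := map _ _; case: (leqP l (size w)) => hl; last first.
  by exists k => //; rewrite [rot l _]rot_oversize // size_rot ltnW.
case: (leqP k (size w)) => hk; last first.
  by exists l => //; rewrite [rot k _]rot_oversize // ltnW.
by rewrite rot_add_mod //; set j := (if _ then _ else _); exists j.
Qed.

Lemma giso_sym b : symmetric (giso b).
Proof.
suff H D D' : giso b D D' -> giso b D' D by move=> D D'; apply/idP/idP; apply: H.
move=> /asboolP[g [gi gs [k kb D'E]]].
pose h a' := nth a' (arrows D) (index a' (map g (arrows D))).
have hK a : a \in arrows D -> h (g a) = a.
  move=> aD; rewrite /h.
  have ilt : (index (g a) (map g (arrows D)) < size (arrows D))%N.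
    by rewrite -(size_map g) index_mem map_f.
  apply: gi => //; first exact: mem_nth.
  by rewrite -(nth_map _ (g a)) // nth_index // map_f.
have gD a' : a' \in arrows D' -> exists2 a, a \in arrows D & a' = g a.
  move=> /(arrows_mem false); rewrite D'E mem_rot => /mapP[x /mem_arrows xD [-> _]].
  by exists x.1.
apply/asboolP; exists h; split.
- move=> x y /gD[a aD ->] /gD[c cD ->]; by rewrite !hK // => ->.
- by move=> x /gD[a aD ->]; rewrite hK //; have [-> ->] := gs _ aD.
pose l := if b is Line then 0%N else (size (gword D') - k)%N.
exists l; first by rewrite /l => ->.
have DE : map (mape h) (map (mape g) D) = gword D.
  rewrite -map_comp -[RHS]map_id; apply/eq_in_map => -[a e] /mem_arrows /= aD.
  by rewrite /mape /= hK.
rewrite /l D'E map_rot DE; case: b kb {l D'E} => kb; first by rewrite kb // !rot0.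
by rewrite size_rot size_map -[X in (X - k)%N](size_rot k) -/(rotr k _) rotK.
Qed.

Definition giso_equiv (b : base) : equiv_rel gauss :=
  EquivRel (giso b) (@giso_refl b) (@giso_sym b) (@giso_trans b).

Definition diagram (b : base) : Type := {eq_quot (giso_equiv b)}.
HB.instance Definition _ (b : base) := Choice.on (diagram b).
HB.instance Definition _ (b : base) : EqQuotient gauss (giso_equiv b) (diagram b) :=
  EqQuotient.on (diagram b).

Definition cls (b : base) (D : gauss) : diagram b := (\pi D).

(* In the next three patterns no interval contains the base point of the word;
   on the circle the remaining cases are reached by changing the representative,
   every use of these patterns being invariant under rotation of the words. *)
Definition isolated (D : gauss) (a : arrow) : Prop :=
  exists u v e, gword D = u ++ [:: (a, e); (a, ~~ e)] ++ v.

Definition bigon (D : gauss) (a b : arrow) : Prop :=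
  sgn a != sgn b /\
  exists u v w s1 s2 e,
    [/\ perm_eq s1 [:: (a, e); (b, e)], perm_eq s2 [:: (a, ~~ e); (b, ~~ e)]
       & gword D = u ++ s1 ++ v ++ s2 ++ w].

(* The arrows are [a : 1 -> 2], [b : 1 -> 3] and [c : 2 -> 3]; [s1], [s2], [s3]
   are the three intervals in the order in which the base meets them. The words
   of [D] and [D'] use the same arrows, and each arrow corresponds to itself. *)
Definition omega3 (D D' : gauss) (a b c : arrow) : Prop :=
  [/\ sgn a = sgn b, sgn b = sgn c &
  exists u0 u1 u2 u3 s1 s2 s3,
    [/\ perm_eq [:: s1; s2; s3]
          [:: [:: (a, false); (b, false)];
              [:: (a, true); (c, false)];
              [:: (b, true); (c, true)]],
        gword D = u0 ++ s1 ++ u1 ++ s2 ++ u2 ++ s3 ++ u3 &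
        gword D' = u0 ++ rev s1 ++ u1 ++ rev s2 ++ u2 ++ rev s3 ++ u3]].

End GaussWords.

Section Parity.
Variable b : base.
Implicit Types (D : gauss unit) (x : arrow unit).

(* A labelling of arrows by [true] (odd, 1) and [false] (even, 0); only the
   values [P D x] with [x] an arrow of [D] matter. [parity_iso] says that [P]
   is defined on diagrams rather than on their words. *)
Record parity (P : gauss unit -> arrow unit -> bool) : Prop := {
  parity_iso : forall g D D', giso_by b g D D' ->
    {in arrows D, forall x, P D' (g x) = P D x};
  parity_isolated : forall D a, isolated D a -> P D a = false;
  parity_omega1 : forall D a, isolated D a ->
    {in arrows (gdel D a), forall x, P (gdel D a) x = P D x};
  parity_bigon : forall D a a', bigon D a a' -> P D a = P D a';
  parity_omega2 : forall D a a', bigon D a a' ->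
    {in arrows (gdel (gdel D a) a'), forall x,
       P (gdel (gdel D a) a') x = P D x};
  parity_triangle : forall D D' a1 a2 a3, omega3 D D' a1 a2 a3 ->
    (P D a1 + P D a2 + P D a3)%N \in [:: 0%N; 2%N];
  parity_omega3 : forall D D' a1 a2 a3, omega3 D D' a1 a2 a3 ->
    {in arrows D, forall x, P D' x = P D x}
}.

End Parity.

(* 1, ..., m+1 for finite m, and 1, 2, ..., oo when m = oo. *)
Definition label_ok (m l : enat) : bool := ele (Some 1%N) l && ele l (esucc m).
Definition label (m : enat) : Type := {l : enat | label_ok m l}.
HB.instance Definition _ (m : enat) := Choice.on (label m).

Lemma ltop_subproof m : label_ok m (esucc m).
Proof. by rewrite /label_ok; case: m => //= m; rewrite leqnn. Qed.
Definition ltop (m : enat) : label m := exist (label_ok m) (esucc m) (ltop_subproof m).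

Section ParityLabelling.
Variable P : gauss unit -> arrow unit -> bool.

Definition fpar (D : gauss unit) : gauss unit := gkeep (fun a => ~~ P D a) D.

Definition fm_dies (m : enat) (D : gauss unit) (x : arrow unit) : pred nat :=
  fun i => [&& (1 <= i)%N, ele (Some i) m & x \notin arrows (iter i fpar D)].

Definition fm_val (m : enat) (D : gauss unit) (x : arrow unit) : enat :=
  match pselect (exists i, fm_dies m D x i) with
  | left ex_i => Some (ex_minn ex_i)
  | right _ => esucc m
  end.

Lemma fm_label_subproof m D x : label_ok m (fm_val m D x).
Proof.
rewrite /fm_val; case: pselect => [h|_]; last exact: ltop_subproof.
case: ex_minnP => i /and3P[i1 im _] _; rewrite /label_ok /= i1 /=.
by case: m im {h} => //= m /leqW.
Qed.
Definition fm_label m D x : label m := exist (label_ok m) (fm_val m D x) (fm_label_subproof m D x).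

End ParityLabelling.

Section Relabel.
Variables (L : choiceType) (g : arrow unit -> L) (D : gauss unit).

Definition relabel_end (x : endpoint unit) : endpoint L := ((x.1.1, g x.1), x.2).

Lemma relabel_subproof : gauss_word (map relabel_end D).
Proof.
case: D => w /= /andP[Uw /allP Aw]; apply/andP; split.
  by rewrite map_inj_uniq // => -[[n []] e] [[n' []] e'] /= [-> _ ->].
apply/allP => _ /mapP[x xw ->] /=; apply/mapP.
by exists (x.1, ~~ x.2) => //; apply: Aw.
Qed.
Definition relabel : gauss L := Gauss relabel_subproof.

End Relabel.

Section Quotients.
Variables (V : zmodType) (S : V -> Prop).

Inductive zspan : V -> Prop :=
| zspan0 : zspan 0
| zspan_add x y : zspan x -> S y -> zspan (x + y)
| zspan_sub x y : zspan x -> S y -> zspan (x - y).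

Definition zspanb : {pred V} := fun x => `[< zspan x >].

Lemma zspanb_closed : zmod_closed zspanb.
Proof.
split; first by apply/asboolP; apply: zspan0.
move=> x y /asboolP xS /asboolP yS; apply/asboolP.
elim: yS => [|y' z _ IH zS|y' z _ IH zS]; first by rewrite subr0.
  by rewrite opprD addrA; apply: zspan_sub.
by rewrite opprB addrCA addrC; apply: zspan_add.
Qed.
HB.instance Definition _ := GRing.isZmodClosed.Build V zspanb zspanb_closed.

Definition zquot : Type := Quotient.quot zspanb.
HB.instance Definition _ := GRing.Zmodule.on zquot.

Definition zproj (x : V) : zquot := (\pi_(Quotient.quot zspanb) x).

End Quotients.

Section Groups.
Variable b : base.

Section Relations.
Variable L : choiceType.
Notation ZD := {freeg (diagram L b)}.
Implicit Types D : gauss L.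

Definition gen D : ZD := << cls b D >>.

(* [lab1] and [lab3] are the conditions on the labels of the isolated arrow
   and of the three arrows of a triangle, [G] the words that may occur. *)
Variables (lab1 : pred L) (lab3 : L -> L -> L -> bool) (t : nat) (G : pred (gauss L)).

Inductive arrow_relation : ZD -> Prop :=
| Q1 D a : G D -> isolated D a -> lab1 (lab a) -> arrow_relation (gen D)
| Q2 D a a' : G D -> bigon D a a' -> lab a = lab a' ->
    arrow_relation (gen D + gen (gdel D a) + gen (gdel D a'))
| Q3 D D' a1 a2 a3 : G D -> omega3 D D' a1 a2 a3 ->
    lab3 (lab a1) (lab a2) (lab a3) ->
    arrow_relation
      ((gen D + gen (gdel D a1) + gen (gdel D a2) + gen (gdel D a3))
       - (gen D' + gen (gdel D' a1) + gen (gdel D' a2) + gen (gdel D' a3)))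
| At D : G D -> (t < size (arrows D))%N -> arrow_relation (gen D).

End Relations.

Definition Polyak (t : nat) :=
  zquot (@arrow_relation unit predT (fun _ _ _ => true) t predT).

Variables (m : enat) (t : nat).

Notation A := (diagram (label m) b).

Definition istop (l : label m) : bool := l == ltop m.

Definition lab3_ok (i j k : label m) : bool :=
  [|| elt (val j) (val i) && (j == k),
      elt (val i) (val j) && (i == k),
      elt (val i) (val k) && (i == j)
    | [&& istop i, istop j & istop k]].

Definition X_rel : {freeg A} -> Prop := arrow_relation istop lab3_ok t predT.
Definition Xgrp := zquot X_rel.
Definition Xproj : {freeg A} -> Xgrp := @zproj _ X_rel.

Definition alltop (D : gauss (label m)) : bool :=
  all (fun a => istop (lab a)) (arrows D).

Definition Ediag : Type := {d : A | alltop (repr d)}.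
HB.instance Definition _ := Choice.on Ediag.

Definition Eincl : {freeg Ediag} -> {freeg A} :=
  fglift (fun d : Ediag => << val d >> : {freeg A}).

(* The relations of [Xgrp] all of whose arrows carry the top label, seen in the
   free abelian group on [Ediag]. *)
Definition E_rel (r : {freeg Ediag}) : Prop :=
  arrow_relation istop lab3_ok t alltop (Eincl r).
Definition Egrp := zquot E_rel.
Definition Eproj : {freeg Ediag} -> Egrp := @zproj _ E_rel.

(* [Lambda] (when [P] is a parity) and [Isub] do not depend on the chosen words
   [repr d], their values being classes up to isomorphism. *)
Section Maps.
Variable P : gauss unit -> arrow unit -> bool.

Definition Lambda : {freeg (diagram unit b)} -> {freeg A} :=
  fglift (fun d : diagram unit b =>
    << cls b (relabel (fm_label P m (repr d)) (repr d)) >> : {freeg A}).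
End Maps.

Definition Isub : {freeg A} -> {freeg A} :=
  fglift (fun d : A =>
    \sum_(F : {set seq_sub (arrows (repr d))})
      gen (gkeep (fun a => a \in map val (enum F)) (repr d))).

End Groups.

(* A knot diagram is polygonal: a closed polygon for the circle; for the line,
   a polygonal path extended by the two horizontal rays that leave its end
   points, so that the curve is the first axis outside a compact set. The pair
   (i, s) with 0 <= s < 1 is the point at proportion s of the i-th edge. *)
Section ClassicalDiagrams.
Variables (R : realType) (b : base).

Definition param : Type := (nat * R)%type.
HB.instance Definition _ := Choice.on param.

Record knot_data := KnotData {
  vertices : seq (R * R);
  over : param -> bool  (* whether this passage of a crossing is the upper one *)
}.

Variable K : knot_data.

Definition vertex (i : nat) : R * R := nth (0, 0) (vertices K) i.
Definition nedges : nat :=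
  if b is Line then (size (vertices K)).-1 else size (vertices K).
Definition edge (i : nat) : R * R :=
  vertex (i.+1 %% size (vertices K)) - vertex i.
Definition det (u v : R * R) : R := u.1 * v.2 - u.2 * v.1.

Definition is_param (x : param) : bool := (x.1 < nedges)%N && (0 <= x.2 < 1).
Definition point (x : param) : R * R :=
  ((vertex x.1).1 + x.2 * (edge x.1).1, (vertex x.1).2 + x.2 * (edge x.1).2).
Definition param_lt (x y : param) : bool :=
  (x.1 < y.1)%N || ((x.1 == y.1) && (x.2 < y.2)).

Definition crossing (x y : param) : Prop :=
  [/\ is_param x, is_param y, x <> y & point x = point y].

Definition knot_diagram : Prop :=
  [/\ match b with
      | Circle => vertices K <> [::]
      | Line =>
          let n := nedges in
          [/\ (vertex 0).1 < (vertex n).1,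
               (vertex 0).2 = 0, (vertex n).2 = 0 &
               forall i, (0 < i < n)%N ->
                 (vertex 0).1 < (vertex i).1 < (vertex n).1]
      end,
      forall x y, crossing x y ->
        [/\ 0 < x.2, 0 < y.2 & det (edge x.1) (edge y.1) != 0],
      forall x y z, crossing x y -> crossing y z -> crossing x z -> False &
      forall x y, crossing x y -> over K x != over K y].

(* [ps] lists the passages through crossings along the knot and [c] sends each
   of them to an endpoint of [D]; arrows go from the upper to the lower
   passage. *)
Definition gauss_diagram_of (D : gauss unit) : Prop :=
  exists (ps : seq param) (c : param -> endpoint unit),
    [/\ sorted param_lt ps /\ (forall x, x \in ps <-> exists y, crossing x y),
        gword D = map c ps,
        {in ps &, forall x y, (c x).1 = (c y).1 <-> point x = point y},
        {in ps, forall x, (c x).2 = ~~ over K x} &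
        forall x y, crossing x y -> over K x ->
          sgn (c x).1 = (0 < det (edge x.1) (edge y.1))].

End ClassicalDiagrams.

Definition classical (R : realType) (b : base) (d : diagram unit b) : Prop :=
  exists (K : knot_data R) (D : gauss unit),
    [/\ knot_diagram b K, gauss_diagram_of b K D & d = cls b D].

(* Main.v *)
From HB Require Import structures.
Require Import Defs.
From mathcomp Require Import all_boot all_order all_algebra.
From mathcomp Require Import generic_quotient ring_quotient boolp reals.
From mathcomp.multinomials Require Import freeg.
From mathcomp Require Import zify ring lra.

Set Implicit Arguments.
Unset Strict Implicit.
Unset Printing Implicit Defensive.
Import Order.TTheory GRing.Theory Num.Theory.
Local Open Scope quotient_scope.
Local Open Scope ring_scope.

(** Labels can be forgotten on the diagrams all of whose arrows carry the top
    label, and put back, so that the group of these diagrams is the Polyak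
    group ([E_to_polyakK], [polyak_to_EK]).  Extend the forgetful map by zero
    to all labelled diagrams.  It still sends relations to relations
    ([forget_X_rel]): a triangle that is not entirely at the top label has two
    arrows below it ([two_below_top]), hence each of its eight terms keeps one
    of them and vanishes.  The forgetful map is therefore defined on the large
    group, where it composes with the inclusion to an isomorphism
    ([X_to_polyak_E]), and the inclusion is injective.

    The last assertion rests on the fact that every arrow of the Gauss diagram
    of a knot in the plane is even, for every parity ([even_of_knot]).  Then
    the deletion of odd arrows changes nothing, all labels are at the top, and
    the sum of the subdiagrams lies in the image of the small group
    ([Isub_Lambda_even]).

    For the vanishing of the parity, cut the curve at its base point and push
    the strand found there across an arbitrary strand of the diagram, on a
    chosen side of it, by a second Reidemeister move.  Gauss diagrams need not
    be planar, so that this is always possible.  The common parity of the two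
    new crossings is a function of the strand and of the side, the
    [potential].  Push the same strand across both strands at one of the four
    corners of a crossing x: a triangle appears, and the parity of x is the
    sum of the potentials of the two sides that bound the corner
    ([parity_corner], [finger_parity_corner]).  Planarity gives a converse
    constraint.  The loop of the curve between the two passages of a crossing
    x0 is the mod 2 boundary of a set of regions; give colour 1 to the corners
    in these regions.  Sum the relation above over the coloured corners of all
    crossings.  The number of coloured corners is odd at x0 only, so that the
    parity of x0 remains on the left.  On the right a coloured side of a strand
    is counted once at each of its two ends, and nothing remains
    ([even_of_colouring]).

    The regions are described by counting the segments of the loop above a
    point of the curve, pushed slightly off the curve.  This parity is the same
    along both strands at a corner ([left_colour_vertex],
    [left_colour_crossing]) and does not change along a segment, because an
    end of a segment of the closed loop is shared by two of them
    ([depth_branches]).  A small shear first makes all segments non-vertical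
    ([generic_shear]). *)

(** * Booleans modulo 2 and sequences *)
Lemma addb_cancel (x y z : bool) : x (+) z (+) (y (+) z) = x (+) y.
Proof. by rewrite addbACA addbb addbF. Qed.

Lemma big_addb_telescope (f : nat -> bool) m n : (m <= n)%N ->
  \big[addb/false]_(m <= i < n) (f i (+) f i.+1) = f m (+) f n.
Proof.
elim: n => [|n IH]; first by rewrite leqn0 => /eqP->; rewrite big_geq // addbb.
rewrite leq_eqVlt => /orP[/eqP<-|mn]; first by rewrite big_geq // addbb.
by rewrite big_nat_recr //= IH // addbA addbK.
Qed.

Lemma addb8 (x1 x2 x3 x4 y1 y2 y3 y4 : bool) :
  x1 (+) y1 (+) (x2 (+) y2) (+) (x3 (+) y3 (+) (x4 (+) y4)) =
  x1 (+) x2 (+) (x3 (+) x4) (+) (y1 (+) y2 (+) (y3 (+) y4)).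
Proof. by rewrite [x1 (+) y1 (+) _]addbACA [x3 (+) y3 (+) _]addbACA addbACA. Qed.

Lemma index_cat_cons (T : eqType) (z : T) p q :
  uniq (p ++ z :: q) -> index z (p ++ z :: q) = size p.
Proof.
rewrite cat_uniq /= negb_or => /and3P[_ /andP[zp _] _].
by rewrite index_cat (negbTE zp) /= eqxx addn0.
Qed.

Lemma take_size_addn (T : Type) (s1 s2 : seq T) k :
  take (size s1 + k) (s1 ++ s2) = s1 ++ take k s2.
Proof. by rewrite take_cat ltnNge leq_addr /= addKn. Qed.

Lemma drop_size_addn (T : Type) (s1 s2 : seq T) k :
  drop (size s1 + k) (s1 ++ s2) = drop k s2.
Proof. by rewrite drop_cat ltnNge leq_addr /= addKn. Qed.

Lemma count_cons (T : Type) (p : pred T) z s : count p (z :: s) = (p z + count p s)%N.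
Proof. by []. Qed.

Lemma perm_pair (T : eqType) (x y : T) : perm_eq [:: x; y] [:: y; x].
Proof. by rewrite (perm_catC [:: x] [:: y]). Qed.

(** * Parities and second Reidemeister moves on words *)
Section WordParity.
Variables (b : base) (P : gauss unit -> arrow unit -> bool).
Hypothesis parP : parity b P.

Notation letter := (endpoint unit).
Implicit Types (w u v : seq letter) (x y : arrow unit).

Fact gauss_nil_proof : gauss_word ([::] : seq letter). Proof. by []. Qed.
Definition gauss_nil : gauss unit := Gauss gauss_nil_proof.

(** The diagrams studied here are built as words.  A word that is not a Gauss
    word is read as the empty diagram. *)
Definition parity_word w x : bool := P (insubd gauss_nil w) x.

Lemma gword_insubd w : gauss_word w -> gword (insubd gauss_nil w) = w.
Proof. by move=> gw; rewrite -[gword _]/(val _) insubdK. Qed.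

Lemma parity_wordE (D : gauss unit) x : parity_word (gword D) x = P D x.
Proof. by rewrite /parity_word -[gword D]/(val D) valKd. Qed.

Lemma gauss_word_perm w w' : perm_eq w w' -> gauss_word w = gauss_word w'.
Proof.
move=> pw; rewrite /gauss_word (perm_uniq pw) (perm_all _ pw).
by congr (_ && _); apply: eq_all => x; rewrite (perm_mem pw).
Qed.

Definition name (z : letter) : nat := z.1.1.1.
Definition rm n w := [seq z <- w | name z != n].
Definition fresh n w := all (fun z => name z != n) w.

(** The two arrows of each bigon built below share a name and differ by their
    signs: to erase a name is to undo a second Reidemeister move. *)
Lemma parity_word_rm n s w u v z s1 s2 e x :
  let a : arrow unit := ((n, s), tt) in let a' : arrow unit := ((n, ~~ s), tt) in
  gauss_word w -> w = u ++ s1 ++ v ++ s2 ++ z ->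
  perm_eq s1 [:: (a, e); (a', e)] -> perm_eq s2 [:: (a, ~~ e); (a', ~~ e)] ->
  (x, false) \in rm n w -> parity_word (rm n w) x = parity_word w x.
Proof.
move=> a a' gw wE p1 p2 xw.
pose D := insubd gauss_nil w; have DE : gword D = w by exact: gword_insubd.
have bD : bigon D a a'.
  split; first by rewrite /sgn /=; case: (s).
  by exists u, v, z, s1, s2, e; rewrite DE.
have E : gword (gdel (gdel D a) a') = rm n w.
  rewrite /gdel /gkeep /= DE -filter_predI; apply: eq_filter => -[[[k t] []] f] /=.
  rewrite /a /a' /name /= !xpair_eqE !andbT.
  by case: (k == n); case: t; case: (s).
rewrite -E parity_wordE (parity_omega2 parP bD) -?parity_wordE ?DE //.
apply: (@mem_arrows _ (gdel (gdel D a) a') (x, false)).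
by rewrite E.
Qed.

(** The two sides of a third Reidemeister move carry the same parities, so that
    the rule for triangles also holds for the pattern with its three orders
    reversed, which is the case [d = true]. *)
Lemma parity_word_triangle w u0 u1 u2 u3 s1 s2 s3 a1 a2 a3 (d : bool) :
  let r := if d then @rev letter else id in
  gauss_word w -> w = u0 ++ s1 ++ u1 ++ s2 ++ u2 ++ s3 ++ u3 ->
  sgn a1 = sgn a2 -> sgn a2 = sgn a3 ->
  perm_eq [:: s1; s2; s3]
    [:: r [:: (a1, false); (a2, false)];
        r [:: (a1, true); (a3, false)];
        r [:: (a2, true); (a3, true)]] ->
  parity_word w a1 (+) parity_word w a2 (+) parity_word w a3 = false.
Proof.
have tri (D D' : gauss unit) c1 c2 c3 : omega3 D D' c1 c2 c3 ->
    P D c1 (+) P D c2 (+) P D c3 = false.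
  by move/(parity_triangle parP); case: (P D c1) (P D c2) (P D c3) => [] [] [].
move=> r gw wE e12 e23 p.
pose w' := u0 ++ rev s1 ++ u1 ++ rev s2 ++ u2 ++ rev s3 ++ u3.
have pw : perm_eq w w'.
  have pr s : perm_eq s (@rev letter s) by rewrite perm_sym perm_rev.
  rewrite wE /w' perm_cat2l; apply: (perm_cat (pr s1)); rewrite perm_cat2l.
  by apply: (perm_cat (pr s2)); rewrite perm_cat2l; apply: (perm_cat (pr s3)).
have gw' : gauss_word w' by rewrite -(gauss_word_perm pw).
pose D := insubd gauss_nil w; pose D' := insubd gauss_nil w'.
have DE : gword D = w by exact: gword_insubd.
have D'E : gword D' = w' by exact: gword_insubd.
case: d @r p => /= p.
  have o : omega3 D' D a1 a2 a3.
    split=> //; exists u0, u1, u2, u3, (rev s1), (rev s2), (rev s3).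
    rewrite !revK DE D'E; split => //.
    by have := perm_map (@rev letter) p.
  have aD c f : (c, f) \in w -> c \in arrows D'.
    by move=> cw; apply: (@mem_arrows _ D' (c, f)); rewrite D'E -(perm_mem pw).
  have aw c : c \in flatten [:: s1; s2; s3] -> c \in w.
    rewrite wE /= !mem_cat in_nil orbF.
    by case/or3P => ->; rewrite ?orbT.
  have fp : flatten [:: s1; s2; s3] =i flatten [:: rev [:: (a1, false); (a2, false)];
        rev [:: (a1, true); (a3, false)];
        rev [:: (a2, true); (a3, true)]].
    by apply: perm_mem; apply: perm_flatten.
  rewrite /parity_word -/D.
  rewrite !(parity_omega3 parP o); first exact: tri o.
  - by apply: (aD a3 false); apply: aw; rewrite fp !inE eqxx ?orbT.
  - by apply: (aD a2 false); apply: aw; rewrite fp !inE eqxx ?orbT.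
  - by apply: (aD a1 false); apply: aw; rewrite fp !inE eqxx ?orbT.
rewrite /parity_word -/D.
apply: (tri D D').
by split=> //; exists u0, u1, u2, u3, s1, s2, s3; rewrite DE D'E.
Qed.

Lemma parity_word_isolated w u v x e :
  gauss_word w -> w = u ++ [:: (x, e); (x, ~~ e)] ++ v -> parity_word w x = false.
Proof.
move=> gw wE; apply: (parity_isolated parP); exists u, v, e.
by rewrite gword_insubd.
Qed.

Lemma parity_word_rot w k x : gauss_word w -> b = Circle ->
  (x, false) \in w -> parity_word (rot k w) x = parity_word w x.
Proof.
move=> gw bC xw.
have gw' : gauss_word (rot k w) by rewrite (gauss_word_perm (w' := w)) ?perm_rot.
rewrite /parity_word -[X in P _ X]/(id x).
apply: (parity_iso parP); last by apply: (@mem_arrows _ _ (x, false)); rewrite gword_insubd.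
split=> //; exists k; first by rewrite bC.
rewrite !gword_insubd //; congr rot; rewrite -[LHS]map_id; apply: eq_map => -[] //.
Qed.

Definition letters_of n : seq letter :=
  [:: ((n, true, tt), true); ((n, true, tt), false);
      ((n, false, tt), true); ((n, false, tt), false)].

Lemma gauss_word_add n w : gauss_word w -> fresh n w ->
  gauss_word (letters_of n ++ w).
Proof.
move=> /andP[uw aw] fw; apply/andP; split; last first.
  rewrite /= !inE !xpair_eqE !eqxx /=; apply/allP => z zw.
  by rewrite !inE (allP aw z zw) !orbT.
have nw f t : ((n, t, tt), f) \notin w.
  by apply/negP => /(allP fw); rewrite eqxx.
rewrite cat_uniq uw /= !inE !xpair_eqE !eqxx /=.
rewrite andbT; apply/hasPn => z zw; rewrite !inE; apply/negP => zE.
by case/or4P: zE zw => /eqP->; rewrite (negbTE (nw _ _)).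
Qed.

Lemma rm_fresh n w : fresh n w -> rm n w = w.
Proof. by move/all_filterP. Qed.

Lemma rm_self n c f w : rm n ((((n, c), tt), f) :: w) = rm n w.
Proof. by rewrite /rm /= /name eqxx. Qed.

Lemma rm_name n m : m != n -> forall c f w,
  rm n ((((m, c), tt), f) :: w) = (((m, c), tt), f) :: rm n w.
Proof. by rewrite /rm => mn c f w /=; rewrite /name mn. Qed.

Lemma rm_arrow n x : x.1.1 != n -> forall f w, rm n ((x, f) :: w) = (x, f) :: rm n w.
Proof. by rewrite /rm => xn f w /=; rewrite /name xn. Qed.

Lemma rm_nil n : rm n [::] = [::]. Proof. by []. Qed.

Lemma rm_cat n w w' : rm n (w ++ w') = rm n w ++ rm n w'.
Proof. exact: filter_cat. Qed.

Lemma fresh_take n k w : fresh n w -> fresh n (take k w).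
Proof. by move=> fw; apply/allP => z /mem_take; apply: (allP fw). Qed.

Lemma fresh_drop n k w : fresh n w -> fresh n (drop k w).
Proof. by move=> fw; apply/allP => z /mem_drop; apply: (allP fw). Qed.

(** The word obtained when the strand before the first letter of [w], the front
    strand, is pushed across the strand at gap [k].  The gap strand is crossed
    from its side [t] and the front strand leads with its side [s], where
    [true] means right; the gap strand passes over if [ov] holds.  Strands that
    face each other with the same side run in opposite directions, whence the
    order of the second pair of letters.  The crossing [y] that the front
    strand meets first is positive exactly if [ov] and [t] agree. *)
Definition finger n w k (ov t s : bool) : seq letter :=
  let y : arrow unit := ((n, ~~ (ov (+) t)), tt) in
  let z : arrow unit := ((n, ov (+) t), tt) in
  [:: (y, ov); (z, ov)] ++ take k w ++
  (if t (+) s then [:: (y, ~~ ov); (z, ~~ ov)] else [:: (z, ~~ ov); (y, ~~ ov)])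
  ++ drop k w.

Definition finger_parity n w k ov t s := parity_word (finger n w k ov t s) ((n, true), tt).

Local Ltac count_lia p :=
  repeat match goal with |- context [nat_of_bool (p ?z)] =>
    move: (nat_of_bool (p z)) => ?
  end; lia.

Lemma gauss_word_finger n w k ov t s : gauss_word w -> fresh n w ->
  gauss_word (finger n w k ov t s).
Proof.
move=> gw fw; rewrite -(gauss_word_perm (_ : perm_eq (letters_of n ++ w) _)).
  exact: gauss_word_add.
rewrite /finger -{1}(cat_take_drop k w); apply/permP => p; rewrite !count_cat.
case: ov t s => [] [] [];  rewrite /=; count_lia p.
Qed.

Lemma rm_finger n w k ov t s : fresh n w -> rm n (finger n w k ov t s) = w.
Proof.
move=> fw; rewrite /finger !rm_cat !(rm_fresh (fresh_take _ _), rm_fresh (fresh_drop _ _)) //.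
rewrite -[RHS](cat_take_drop k w).
by case: (t (+) s); rewrite /rm /name /= eqxx.
Qed.

Lemma mem_finger n w k ov t s c f : ((n, c), tt, f) \in finger n w k ov t s.
Proof.
by case: ov t s c f => [] [] [] [] [];
  rewrite /finger !(mem_cat, inE) !xpair_eqE !eqxx /= ?orbT.
Qed.

Lemma finger_parityE n w k ov t s c : gauss_word w -> fresh n w ->
  parity_word (finger n w k ov t s) ((n, c), tt) = finger_parity n w k ov t s.
Proof.
move=> gw fw; case: c => //; apply: (parity_bigon parP); split=> //.
exists [::], (take k w), (drop k w); do 2!eexists; exists ov.
rewrite gword_insubd; last exact: gauss_word_finger.
split; last exact: (erefl (finger n w k ov t s)).
  by case: ov t s => [] [] [] //=; apply: perm_pair.
by case: ov t s => [] [] [] //=; apply: perm_pair.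
Qed.

Lemma parity_word_finger n w k ov t s x : gauss_word w -> fresh n w ->
  (x, false) \in w -> parity_word (finger n w k ov t s) x = parity_word w x.
Proof.
move=> gw fw xw; rewrite -[in RHS](@rm_finger n w k ov t s) //.
symmetry; have gf := gauss_word_finger k ov t s gw fw.
have xr : (x, false) \in rm n (finger n w k ov t s) by rewrite rm_finger.
apply: (@parity_word_rm n true _ [::] (take k w) (drop k w) _ _ ov x gf (erefl _)) => /=.
- by case: ov t s {gf xr} => [] [] [] //=; apply: perm_pair.
- by case: ov t s {gf xr} => [] [] [] //=; apply: perm_pair.
exact: xr.
Qed.

Local Ltac rm_insertion ova ovb s e E :=
  case: ova ovb s e E => [] [] [] [] [] //;
  let m1 := fresh in let m2 := fresh in let n12 := fresh in let n21 := fresh in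
  move=> _ m1 m2 n12 n21;
  cbv beta iota delta [addb negb implb nat_of_bool];
  rewrite !(rm_self, rm_name n12, rm_name n21, rm_arrow m1, rm_arrow m2, rm_nil);
  rewrite -?addnA !(take_size_addn, drop_size_addn) ?addSn /=
    ?take_size_addn ?drop_size_addn ?take0 ?drop0 ?cats0 ?addn0;
  rewrite ?take_size_cat ?drop_size_cat -?catA //=;
  rewrite ?take0 ?drop0 -?catA //=.

Local Ltac triangle_perm E s e :=
  move: (E) (s) (e); clear; move=> [] [] []; apply/permP;
  let p := fresh in move=> p; rewrite /rev /=; count_lia p.

(** The front strand is pushed across both strands of the crossing [x] near the
    corner which lies on the side [ta] of the strand of the tail and on the
    side [tb] of the strand of the head.  On either finger, one of the two new
    crossings is next to [x]; these two and [x] are the vertices of a triangle,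
    and a third Reidemeister move applies to it.  The sign of [x] tells whether
    the corner is before or after [x] on each strand, and [e = true] if the
    head of [x] comes first in the word.  The strands of [x] pass over the front
    strand according to [ova] and [ovb]; [ovb ==> ova] excludes the cyclic
    arrangement of the three levels, and the definitions of [ta] and [tb] are
    the conditions for the three signs of the triangle to agree. *)
Lemma parity_corner n1 n2 w u1 u2 u3 x e ova ovb s :
  gauss_word w -> w = u1 ++ (x, e) :: u2 ++ (x, ~~ e) :: u3 ->
  fresh n1 w -> fresh n2 w -> n1 != n2 -> ovb ==> ova ->
  let ta := ~~ ovb (+) s in let tb := ova (+) s in
  let i1 := size u1 in let i2 := (size u1 + (size u2).+1)%N in
  parity_word w x =
    finger_parity n1 w ((if e then i2 else i1) + (tb (+) ~~ sgn x)) ova ta s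
    (+) finger_parity n2 w ((if e then i1 else i2) + (ta (+) sgn x)) ovb tb s.
Proof.
move=> gw wE f1 f2 n12 ovab ta tb i1 i2.
set ka := (_ + _)%N; set kb := (_ + _)%N.
set E := sgn x.
(* The crossings next to [x] have the sign of [x], those that complete the
   bigons have the opposite one. *)
pose near n f : letter := ((n, E, tt), f); pose far n f : letter := ((n, ~~ E, tt), f).
(* The front strand meets the finger of the tail strand first if [c] holds. *)
pose c := ~~ (ova (+) ta) (+) E.
pose F := if c then [:: far n1 ova; near n1 ova; near n2 ovb; far n2 ovb]
               else [:: far n2 ovb; near n2 ovb; near n1 ova; far n1 ova].
pose Ba := if tb (+) ~~ E then [:: (x, false); near n1 (~~ ova); far n1 (~~ ova)]
           else [:: far n1 (~~ ova); near n1 (~~ ova); (x, false)].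
pose Bb := if ta (+) E then [:: (x, true); near n2 (~~ ovb); far n2 (~~ ovb)]
           else [:: far n2 (~~ ovb); near n2 (~~ ovb); (x, true)].
pose W := F ++ u1 ++ (if e then Bb else Ba) ++ u2 ++ (if e then Ba else Bb) ++ u3.
have [g1 g2] : fresh n1 u1 /\ fresh n2 u1.
  by split; [move: f1|move: f2]; rewrite wE /fresh all_cat => /andP[].
have [h1 h2] : fresh n1 u2 /\ fresh n2 u2.
  by split; [move: f1|move: f2]; rewrite wE /fresh all_cat /= all_cat => /and4P[].
have [k1 k2] : fresh n1 u3 /\ fresh n2 u3.
  by split; [move: f1|move: f2]; rewrite wE /fresh all_cat /= all_cat => /and4P[_ _ _ /andP[]].
have [l1 l2] : name (x, e) != n1 /\ name (x, e) != n2.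
  by split; [move: f1|move: f2]; rewrite wE /fresh all_cat /= => /and3P[].
have gW : gauss_word W.
  have gA := gauss_word_add gw f1.
  have fA : fresh n2 (letters_of n1 ++ w).
    by rewrite /fresh all_cat -/(fresh n2 w) f2 /= /name /= n12.
  rewrite -(gauss_word_perm (_ : perm_eq (letters_of n2 ++ letters_of n1 ++ w) _)).
    exact: gauss_word_add.
  rewrite wE /W /F /Ba /Bb /c /far /near /ta /tb.
  apply/permP => p.
  rewrite /E; move: (sgn x) => E'; clear.
  by case: ova ovb s e E' => [] [] [] [] [] /=; rewrite !(count_cat, count_cons) /=; count_lia p.
have [m1 m2] : x.1.1 != n1 /\ x.1.1 != n2 by [].
have n21 : n2 != n1 by rewrite eq_sym.
(* Undoing one of the two fingers leaves the other one on [w]. *)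
have rB : rm n2 W = finger n1 w ka ova ta s.
{ rewrite /W !rm_cat !(rm_fresh g2, rm_fresh h2, rm_fresh k2) /finger.
  rewrite /F /Ba /Bb /c /ka /far /near /E /ta /tb wE /i1 /i2 {l1 l2 gW}.
  move: (sgn x) => E'; move: ovab m1 m2 n12 n21; clear.
  rm_insertion ova ovb s e E'. }
have rA : rm n1 W = finger n2 w kb ovb tb s.
{ rewrite /W !rm_cat !(rm_fresh g1, rm_fresh h1, rm_fresh k1) /finger.
  rewrite /F /Ba /Bb /c /kb /far /near /E /ta /tb wE /i1 /i2 {l1 l2 gW}.
  move: (sgn x) => E'; move: ovab m1 m2 n12 n21; clear.
  rm_insertion ova ovb s e E'. }
pose ca := tb (+) ~~ E; pose cb := ta (+) E.
have PB y : (y, false) \in rm n2 W -> parity_word (rm n2 W) y = parity_word W y.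
  apply: (@parity_word_rm n2 E W
    (if c then [:: far n1 ova; near n1 ova] else [::])
    ((if c then [::] else [:: near n1 ova; far n1 ova]) ++ u1 ++
      (if e then (if cb then [:: (x, true)] else [::])
       else Ba ++ u2 ++ (if cb then [:: (x, true)] else [::])))
    ((if cb then [::] else [:: (x, true)]) ++ (if e then u2 ++ Ba ++ u3 else u3))
    (if c then [:: near n2 ovb; far n2 ovb] else [:: far n2 ovb; near n2 ovb])
    (if cb then [:: near n2 (~~ ovb); far n2 (~~ ovb)]
     else [:: far n2 (~~ ovb); near n2 (~~ ovb)]) ovb _ gW).
  - rewrite /W /F /Bb -/cb.
    by case: (c); case: (cb); case: (e); rewrite -?catA /= -?catA.
  - by case: (c) => //; apply: perm_pair.
  - by case: (cb) => //; apply: perm_pair.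
have PA y : (y, false) \in rm n1 W -> parity_word (rm n1 W) y = parity_word W y.
  apply: (@parity_word_rm n1 E W
    (if c then [::] else [:: far n2 ovb; near n2 ovb])
    ((if c then [:: near n2 ovb; far n2 ovb] else [::]) ++ u1 ++
      (if e then Bb ++ u2 ++ (if ca then [:: (x, false)] else [::])
       else (if ca then [:: (x, false)] else [::])))
    ((if ca then [::] else [:: (x, false)]) ++ (if e then u3 else u2 ++ Bb ++ u3))
    (if c then [:: far n1 ova; near n1 ova] else [:: near n1 ova; far n1 ova])
    (if ca then [:: near n1 (~~ ova); far n1 (~~ ova)]
     else [:: far n1 (~~ ova); near n1 (~~ ova)]) ova _ gW).
  - rewrite /W /F /Ba -/ca.
    by case: (c); case: (ca); case: (e); rewrite -?catA /= -?catA.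
  - by case: (c) => //; apply: perm_pair.
  - by case: (ca) => //; apply: perm_pair.
have pB : parity_word W ((n1, E), tt) = finger_parity n1 w ka ova ta s.
  by rewrite -(finger_parityE _ _ _ _ E gw f1) -rB PB // rB mem_finger.
have pA : parity_word W ((n2, E), tt) = finger_parity n2 w kb ovb tb s.
  by rewrite -(finger_parityE _ _ _ _ E gw f2) -rA PA // rA mem_finger.
have xw : (x, false) \in w.
  by rewrite wE; case: (e); rewrite !(mem_cat, inE) eqxx ?orbT.
have pX : parity_word W x = parity_word w x.
  rewrite -(parity_word_finger ka ova ta s gw f1 xw) -rB PB //.
  have : (x, false) \in rm n1 (rm n2 W) by rewrite rB rm_finger.
  by rewrite mem_filter => /andP[].
(* [so], [sa] and [sb] are the three intervals of the triangle; the remaining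
   letters of the fingers are outside, at places that depend on the corner. *)
pose sa := if ca then [:: (x, false); near n1 (~~ ova)] else [:: near n1 (~~ ova); (x, false)].
pose sb := if cb then [:: (x, true); near n2 (~~ ovb)] else [:: near n2 (~~ ovb); (x, true)].
pose so := if c then [:: near n1 ova; near n2 ovb] else [:: near n2 ovb; near n1 ova].
pose qa (c' : bool) := if c' then [:: far n1 (~~ ova)] else [::].
pose qb (c' : bool) := if c' then [:: far n2 (~~ ovb)] else [::].
have WE : W = [:: if c then far n1 ova else far n2 ovb] ++ so ++
   ((if c then far n2 ovb else far n1 ova) :: u1 ++ (if e then qb (~~ cb) else qa (~~ ca)))
   ++ (if e then sb else sa) ++
   ((if e then qb cb else qa ca) ++ u2 ++ (if e then qa (~~ ca) else qb (~~ cb)))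
   ++ (if e then sa else sb) ++ ((if e then qa ca else qb cb) ++ u3).
  rewrite /W /F /Ba /Bb -/ca -/cb /so /sa /sb /qa /qb.
  by case: (c); case: (ca); case: (cb); case: (e); rewrite -?catA /= -?catA.
pose A1 : arrow unit := ((n1, E), tt); pose A2 : arrow unit := ((n2, E), tt).
rewrite -pX -pA -pB -/A1 -/A2.
have T := parity_word_triangle (d := ~~ c) gW WE.
have tri3 (p q r : bool) : p (+) q (+) r = false -> (p = q (+) r) * (q = p (+) r) * (r = p (+) q).
  by case: p q r => [] [] [].
(* The front strand is at the top, in the middle, at the bottom of the
   triangle. *)
case ovaE : ova; case ovbE : ovb; [| | by move: ovab; rewrite ovaE ovbE|]; last first.
- apply: (tri3 _ _ _ (T A1 A2 x erefl erefl _)).2.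
  rewrite /so /sa /sb /c /ca /cb /ta /tb /near /A1 /A2 ?ovaE ?ovbE.
  by triangle_perm E s e.
- apply: (tri3 _ _ _ (T A1 x A2 erefl erefl _)).1.2.
  rewrite /so /sa /sb /c /ca /cb /ta /tb /near /A1 /A2 ?ovaE ?ovbE.
  by triangle_perm E s e.
- apply: (tri3 _ _ _ (T x A1 A2 erefl erefl _)).1.1.
  rewrite /so /sa /sb /c /ca /cb /ta /tb /near /A1 /A2 ?ovaE ?ovbE.
  by triangle_perm E s e.
Qed.

Lemma finger_parity_rename n n' w k ov t s : gauss_word w -> fresh n w -> fresh n' w ->
  finger_parity n w k ov t s = finger_parity n' w k ov t s.
Proof.
move=> gw fn fn'.
pose g (x : arrow unit) : arrow unit := if x.1.1 == n then ((n', x.1.2), tt) else x.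
have gE : finger n' w k ov t s = map (mape g) (finger n w k ov t s).
  have gf u : fresh n u -> map (mape g) u = u.
    move=> fu; rewrite -[RHS]map_id; apply/eq_in_map => -[x f] /(allP fu) /=.
    by rewrite /name /mape /g /= => /negbTE ->.
  rewrite /finger !map_cat (gf _ (fresh_take k fn)) (gf _ (fresh_drop k fn)).
  by case: ov t s => [] [] []; rewrite /= /mape /g /= !eqxx.
symmetry; rewrite /finger_parity /parity_word.
have -> : ((n', true), tt) = g ((n, true), tt) by rewrite /g /= eqxx.
apply: (parity_iso parP (g := g) (D := insubd gauss_nil (finger n w k ov t s))).
  split; last by exists 0%N => //; rewrite rot0 !gword_insubd ?gauss_word_finger.
  - have nn' x : x \in arrows (insubd gauss_nil (finger n w k ov t s)) ->
        x.1.1 != n -> x.1.1 != n'.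
      move=> /(arrows_mem true); rewrite gword_insubd ?gauss_word_finger // => xw xn.
      have : (x, true) \in rm n (finger n w k ov t s) by rewrite mem_filter xw andbT.
      by rewrite rm_finger // => /(allP fn').
    move=> x y /nn' xD /nn' yD; rewrite /g.
    case: eqP xD => [xn _|_ /(_ isT) xn']; case: eqP yD => [yn _|_ /(_ isT) yn'] //.
    + by move: x y xn yn => [[? ?] []] [[? ?] []] /= -> -> [->].
    + by move=> E; rewrite -E eqxx in yn'.
    by move=> E; rewrite E eqxx in xn'.
  by move=> [[n0 c] l] _; rewrite /g /sgn /lab /=; case: ifP; case: l.
have := @mem_arrows _ (insubd gauss_nil (finger n w k ov t s)) ((n, true, tt), false).
by apply; rewrite gword_insubd ?gauss_word_finger // mem_finger.
Qed.

Lemma ex_fresh w : exists N, forall n, (N <= n)%N -> fresh n w.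
Proof.
exists (\max_(z <- w) name z).+1 => n nN; apply/allP => z zw.
by rewrite neq_ltn (leq_ltn_trans _ nN) //; apply: (leq_bigmax_seq (F := name)).
Qed.

(** A second finger keeps its parity when the first one is withdrawn.  It starts
    at the front and ends either there or at the gap just outside the bigon of
    the first finger, next to the crossing that the front strand meets first.
    The latter is before or after the second pair of letters of the first
    finger, according to the directions of its strands. *)
Lemma finger_parity_erase m n w k (ov t s : bool) p k' ov' t' s' :
  let D := finger m w k ov t s in
  gauss_word w -> fresh m w -> fresh n D -> (k <= size w)%N ->
  (p = 0%N /\ k' = 0%N) \/ (p = k + 2 + (~~ (t (+) s)).*2 /\ k' = k)%N ->
  finger_parity n D p ov' t' s' = finger_parity n w k' ov' t' s'.
Proof.
move=> D gw fm fn kw pk.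
have fnw : fresh n w.
  apply/allP => z zw; apply: (allP fn); rewrite /D /finger.
  rewrite -(cat_take_drop k w) in zw; move: zw; rewrite !mem_cat => /orP[] ->; rewrite ?orbT //.
have nm : n != m.
  have := allP fn (((m, true), tt), true); rewrite mem_finger => /(_ isT).
  by rewrite /name /= eq_sym.
have mn : m != n by rewrite eq_sym.
have gD : gauss_word D by exact: gauss_word_finger.
pose y : arrow unit := ((m, ~~ (ov (+) t)), tt).
pose z : arrow unit := ((m, ov (+) t), tt).
pose F f : seq letter := [:: (y, f); (z, f)].
pose Fr f : seq letter := [:: (z, f); (y, f)].
pose B := if t (+) s then F (~~ ov) else Fr (~~ ov).
have rF f : rm m (F f) = [::] by rewrite !rm_self.
have rFr f : rm m (Fr f) = [::] by rewrite !rm_self.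
have rB : rm m B = [::] by rewrite /B; case: ifP.
have [ft fd] := (rm_fresh (fresh_take k fm), rm_fresh (fresh_drop k fm)).
have sk : size (take k w) = k by rewrite size_takel.
pose F' : seq letter := [:: ((n, ~~ (ov' (+) t'), tt), ov'); ((n, ov' (+) t', tt), ov')].
pose B' : seq letter := if t' (+) s'
  then [:: ((n, ~~ (ov' (+) t'), tt), ~~ ov'); ((n, ov' (+) t', tt), ~~ ov')]
  else [:: ((n, ov' (+) t', tt), ~~ ov'); ((n, ~~ (ov' (+) t'), tt), ~~ ov')].
have rF' : rm m F' = F' by rewrite !(rm_name nm).
have rB' : rm m B' = B' by rewrite /B'; case: ifP => _; rewrite !(rm_name nm).
have [u [v [r [E fr]]]] : exists u v r, finger n D p ov' t' s' = u ++ F ov ++ v ++ B ++ r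
    /\ rm m (u ++ v ++ r) = finger n w k' ov' t' s'.
  case: pk => -[-> ->].
    exists (F' ++ B'), (take k w), (drop k w); split; first by rewrite -catA /finger take0 drop0.
    by rewrite cat_take_drop !rm_cat rF' rB' rm_fresh // /finger take0 drop0 -catA.
  have DE : D = F ov ++ take k w ++ B ++ drop k w by [].
  rewrite {1}/finger DE -/F' -/B'.
  have [par|par] := boolP (t (+) s).
    exists F', (take k w ++ B'), (drop k w); split; last first.
      by rewrite !rm_cat rF' rB' ft fd -catA.
    by rewrite /B par (_ : k + 2 + (~~ true).*2 = k.+2)%N ?addn2 ?addn0 //= take_size_cat // drop_size_cat // -?catA.
  exists F', (take k w), (B' ++ drop k w); split; last first.
    by rewrite !rm_cat rF' rB' ft fd.
  have tk r := take_size_addn (take k w) r 2; have dk r := drop_size_addn (take k w) r 2.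
  rewrite sk in tk dk; rewrite (_ : k + 2 + 1.*2 = (k + 2).+2)%N; last lia.
  by rewrite /B (negbTE par) /= tk dk /= take0 drop0 -?catA.
have pm f : perm_eq (Fr f) (F f) by exact: perm_pair.
have rE : rm m (finger n D p ov' t' s') = finger n w k' ov' t' s'.
  by rewrite E -fr !rm_cat rF rB.
rewrite /finger_parity -rE; symmetry.
have ym : z = ((m, ~~ ~~ (ov (+) t)), tt) by rewrite negbK.
apply: (@parity_word_rm m (~~ (ov (+) t)) _ u v r (F ov) B ov) => //.
- exact: gauss_word_finger.
- by rewrite negbK.
- by rewrite negbK /B; case: (t (+) s) => //; apply: pm.
by rewrite rE mem_finger.
Qed.

(** A finger is itself a crossing pair, so that [parity_corner] applies to the
    corner outside its bigon at the crossing which the front strand meets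
    first.  There the front strand is pushed once more across the strand at gap
    [k], and across itself; afterwards the original finger is withdrawn.  The
    levels [ova], [ovb] and the side [s] of the new fingers are free, up to the
    constraints of [parity_corner]. *)
Lemma finger_parity_triangle n w k (ov t s' ova ovb s : bool) :
  gauss_word w -> fresh n w -> (k <= size w)%N -> ovb ==> ova ->
  (if ov then (t == ~~ ovb (+) s) && (s' == ova (+) s)
   else (s' == ~~ ovb (+) s) && (t == ova (+) s)) ->
  finger_parity n w k ov t s' =
    finger_parity n w k (if ov then ova else ovb) t s
    (+) finger_parity n w 0 (if ov then ovb else ova) s' s.
Proof.
move=> gw fn kw ovab sides; have [N Nf] := ex_fresh w.
rewrite !(finger_parity_rename _ _ _ _ gw fn (Nf _ (leqnn N))).
pose D := finger N w k ov t s'.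
have gD : gauss_word D by apply: gauss_word_finger => //; apply: Nf.
have [N' N'f] := ex_fresh D.
have sk : size (take k w) = k by rewrite size_takel.
pose x : arrow unit := ((N, ~~ (ov (+) t)), tt); pose z : arrow unit := ((N, ov (+) t), tt).
pose u2 := (z, ov) :: take k w ++ (if t (+) s' then [::] else [:: (z, ~~ ov)]).
pose u3 := (if t (+) s' then [:: (z, ~~ ov)] else [::]) ++ drop k w.
have DE : D = [::] ++ (x, ov) :: u2 ++ (x, ~~ ov) :: u3.
  by rewrite /D /finger /u2 /u3; case: (t (+) s'); rewrite /= -?catA.
have C := parity_corner s gD DE (N'f _ (leqnn _)) (N'f _ (leqnSn _)) _ ovab.
rewrite -(finger_parityE k ov t s' (~~ (ov (+) t)) gw (Nf _ (leqnn N))) {}C; last lia.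
rewrite /sgn /= add0n size_cat sk.
have NN : fresh N w by apply: Nf.
have N'N n' : (N' <= n')%N -> fresh n' w.
  move=> N'n; apply/allP => l lw; apply: (allP (N'f n' N'n)); rewrite /D /finger.
  rewrite -(cat_take_drop k w) in lw; move: lw; rewrite !mem_cat => /orP[] ->; rewrite ?orbT //.
have er n' p k' ov' t' r : (N' <= n')%N ->
    (p = 0%N /\ k' = 0%N) \/ (p = k + 2 + (~~ (t (+) s')).*2 /\ k' = k)%N ->
    finger_parity n' D p ov' t' r = finger_parity N w k' ov' t' r.
  move=> Nn pk; rewrite (finger_parity_erase _ _ _ gw NN (N'f n' Nn) kw pk).
  exact: (finger_parity_rename _ _ _ _ gw (N'N _ Nn) NN).
case: (ov) sides er => /andP[/eqP tE /eqP s'E] er; rewrite -tE -s'E.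
  rewrite (er _ _ k) ?(er _ _ 0%N) //.
    by left; split=> //; case: (t).
  by right; split=> //; case: (t) (s') => [] [] /=; rewrite ?addn0 ?addn1 ?addn2.
rewrite (er _ _ 0%N) ?(er _ _ k) 1?addbC //.
  by right; split=> //; case: (t) (s') => [] [] /=; rewrite ?addn0 ?addn1 ?addn2.
by left; split=> //; case: (t).
Qed.

(** Pushed across itself with equal sides, the front strand forms a kink: one of
    the two new arrows is isolated. *)
Lemma finger_parity_front n w ov t : gauss_word w -> fresh n w ->
  finger_parity n w 0 ov t t = false.
Proof.
move=> gw fn; rewrite -(finger_parityE 0 ov t t (ov (+) t) gw fn).
have gf := gauss_word_finger 0 ov t t gw fn.
apply: (parity_word_isolated gf (u := [:: ((n, ~~ (ov (+) t), tt), ov)])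
  (v := ((n, ~~ (ov (+) t), tt), ~~ ov) :: w) (e := ov)).
by rewrite /finger take0 drop0 addbb.
Qed.

(** On the circle the last gap and the front belong to one arc, and the kink
    contains the base point. *)
Lemma finger_parity_back n w ov t : b = Circle -> gauss_word w -> fresh n w ->
  finger_parity n w (size w) ov t t = false.
Proof.
move=> bC gw fn; have gf := gauss_word_finger (size w) ov t t gw fn.
rewrite -(finger_parityE _ ov t t (~~ (ov (+) t)) gw fn).
rewrite -(parity_word_rot (size w).+3 gf bC) ?mem_finger //.
set y : arrow unit := ((n, ~~ (ov (+) t)), tt); set z : arrow unit := ((n, ov (+) t), tt).
have E : rot (size w).+3 (finger n w (size w) ov t t) =
    [::] ++ [:: (y, ~~ ov); (y, ov)] ++ (z, ov) :: w ++ [:: (z, ~~ ov)].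
  rewrite /finger take_size drop_size addbb -/y -/z cats0.
  rewrite [X in rot _ X](_ : _ = ([:: (y, ov); (z, ov)] ++ w ++ [:: (z, ~~ ov)]) ++ [:: (y, ~~ ov)]).
    rewrite (_ : (size w).+3 = size ([:: (y, ov); (z, ov)] ++ w ++ [:: (z, ~~ ov)])).
      by rewrite rot_size_cat.
    by rewrite !size_cat /= addn1.
  by rewrite -!catA.
rewrite E; apply: (parity_word_isolated (u := [::]) (v := (z, ov) :: w ++ [:: (z, ~~ ov)])
   (e := ~~ ov)); last by rewrite negbK.
by rewrite -E (gauss_word_perm (w' := finger n w (size w) ov t t)) ?perm_rot.
Qed.

Section Potential.
Local Opaque finger_parity parity_word.
Variables (w : seq letter) (n : nat).
Hypotheses (gw : gauss_word w) (fn : fresh n w).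

(** Among the ways of pushing the front strand across the side [t] of gap [k]:
    from below, and led by its right side.  The other ways are compared with
    this one in the next lemmas. *)
Definition potential k t := finger_parity n w k true t true.

(** The front strand pushed across itself with its two different sides. *)
Let twist t := finger_parity n w 0 false t (~~ t).

(** To change the leading side of the front strand costs a correction that does
    not depend on the gap, so that it cancels in the sum of two potentials. *)
Lemma finger_parity_twist k t : (k <= size w)%N ->
  finger_parity n w k true t t = finger_parity n w k true t (~~ t) (+) twist t.
Proof.
move=> kw; rewrite (@finger_parity_triangle n w k true t t true false (~~ t)) //.
by rewrite addTb negbK eqxx.
Qed.

(** To change the level of the front strand costs nothing if the two strands
    are parallel, because the correction is then the parity of a kink. *)
Lemma finger_parity_under k t : (k <= size w)%N ->
  finger_parity n w k true t (~~ t) = finger_parity n w k false t (~~ t).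
Proof.
move=> kw; rewrite (@finger_parity_triangle n w k true t (~~ t) false false (~~ t)) //.
  by rewrite finger_parity_front // addbF.
by rewrite addTb negbK !eqxx.
Qed.

Lemma twist_sides t : twist t = twist (~~ t).
Proof.
suff E : twist false = twist true by case: t; [apply: esym|]; apply: E.
rewrite /twist (@finger_parity_triangle n w 0 false false true false false false) //.
by rewrite finger_parity_front.
Qed.

(** Each corner of [x] forces the levels and the side in [parity_corner].  All
    four cases take the same form once expressed by the potential: the
    corrections occur in pairs. *)
Lemma finger_parity_corner u1 u2 u3 x e ta tb :
  w = u1 ++ (x, e) :: u2 ++ (x, ~~ e) :: u3 ->
  let i1 := size u1 in let i2 := (size u1 + (size u2).+1)%N in
  parity_word w x = potential ((if e then i2 else i1) + (tb (+) ~~ sgn x)) ta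
                (+) potential ((if e then i1 else i2) + (ta (+) sgn x)) tb.
Proof.
move=> wE i1 i2; have [N Nf] := ex_fresh w.
set ka := (_ + _)%N; set kb := (_ + _)%N.
have [kaw kbw] : (ka <= size w)%N /\ (kb <= size w)%N.
  rewrite /ka /kb /i1 /i2 wE !size_cat /= !size_cat /=.
  by case: (e); case: (_ (+) sgn x); case: (_ (+) ~~ sgn x); lia.
have C ova ovb s (ovab : ovb ==> ova) (E : ~~ ovb (+) s = ta) (E' : ova (+) s = tb) :
    parity_word w x = finger_parity n w ka ova ta s (+) finger_parity n w kb ovb tb s.
  have NN : N != N.+1 by rewrite neq_ltn leqnn.
  have := parity_corner s gw wE (Nf N (leqnn N)) (Nf N.+1 (leqnSn N)) NN ovab.
  rewrite E E' -/i1 -/i2 -/ka -/kb => ->.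
  rewrite (finger_parity_rename ka ova ta s gw (Nf N (leqnn N)) fn).
  by rewrite (finger_parity_rename kb ovb tb s gw (Nf N.+1 (leqnSn N)) fn).
rewrite /potential.
have [T1 T2] := (finger_parity_twist, finger_parity_under).
clearbody ka kb.
case: ta C; case: tb => C.
- rewrite (C true false false isT erefl erefl) -(T2 kb true kbw) !(T1 _ _ kaw) !(T1 _ _ kbw).
  exact: esym (addb_cancel _ _ _).
- exact: (C true true true isT erefl erefl).
- rewrite (C true true false isT erefl erefl) (T1 ka false kaw) (T1 kb true kbw).
  by rewrite (twist_sides true) addbAC addbA.
by rewrite (C true false true isT erefl erefl) -(T2 kb false kbw).
Qed.

(** The two gaps are one arc of the circle, cut at the base point.  Both
    potentials are the parity of a kink, up to the correction for the leading
    side. *)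
Lemma potential_rot t : b = Circle -> potential 0 t = potential (size w) t.
Proof.
move=> bC; have := finger_parity_front true t gw fn.
have := finger_parity_back true t bC gw fn.
have cancel (p q r : bool) : p (+) r = false -> q (+) r = false -> q = p.
  by case: p q r => [] [] [].
rewrite /potential; case: t; first by move=> -> ->.
by rewrite (finger_parity_twist _ (leq0n _)) (finger_parity_twist _ (leqnn _)); apply: cancel.
Qed.

End Potential.

Lemma word_split w x : uniq w -> (x, false) \in w -> (x, true) \in w ->
  exists u1 u2 u3 e, [/\ w = u1 ++ (x, e) :: u2 ++ (x, ~~ e) :: u3,
    (if e then (size u1 + (size u2).+1)%N else size u1) = index (x, false) w &
    (if e then size u1 else (size u1 + (size u2).+1)%N) = index (x, true) w].
Proof.
move=> uw xf xt.
have [u1 [u2 [u3 [e wE]]]] : exists u1 u2 u3 e, w = u1 ++ (x, e) :: u2 ++ (x, ~~ e) :: u3.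
  case/splitPr: xf xt => p1 p2; rewrite mem_cat inE xpair_eqE andbF /=.
  case/orP => /splitPr[q1 q2].
    by exists q1, q2, p2, true; rewrite -catA.
  by exists p1, q1, q2, false.
have i1 : index (x, e) w = size u1 by rewrite wE index_cat_cons // -wE.
have i2 : index (x, ~~ e) w = (size u1 + (size u2).+1)%N.
  rewrite wE -cat_cons catA index_cat_cons ?size_cat //.
  by rewrite -catA cat_cons -wE.
by exists u1, u2, u3, e; split=> //; case: (e) i1 i2.
Qed.

(** Think of [chi k t] as the colour, modulo 2, of the region on the side [t] of
    the strand at gap [k].  By the first condition each corner has a colour.  By
    the second one the number of coloured corners at [x] is odd only for
    [x = x0].  Sum the corner relation [finger_parity_corner] over the coloured
    corners of the diagram.  The parities of the crossings add up to the one of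
    [x0].  The potential at a gap and a side occurs twice, for the passages
    before and after the gap, except at the two ends of the word; these are one
    arc of the circle, or are not coloured. *)
Lemma even_of_colouring w (chi : nat -> bool -> bool) x0 :
  gauss_word w -> (x0, false) \in w ->
  (forall x, (x, false) \in w -> forall ta tb,
     chi (index (x, false) w + (tb (+) ~~ sgn x))%N ta =
     chi (index (x, true) w + (ta (+) sgn x))%N tb) ->
  (forall x, (x, false) \in w -> let i := index (x, false) w in
     chi i false (+) chi i true (+) (chi i.+1 false (+) chi i.+1 true) = (x == x0)) ->
  (b = Circle /\ chi 0%N =1 chi (size w)) \/ (chi 0%N =1 xpred0 /\ chi (size w) =1 xpred0) ->
  parity_word w x0 = false.
Proof.
move=> gw x0w chi_eq chi_sum chi_end; have [n nf] := ex_fresh w.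
have fn := nf n (leqnn n).
pose h := potential w n.
(* [F k] is the contribution of gap [k], and [G k] that of the passage between
   gaps [k] and [k.+1]. *)
pose F k := (chi k false && h k false) (+) (chi k true && h k true).
pose G k := F k (+) F k.+1.
have uw : uniq w by case/andP: gw.
have xt x : (x, false) \in w -> (x, true) \in w.
  by case/andP: gw => _ /allP a /a.
have FE x : (x, false) \in w ->
  (x == x0) && parity_word w x = G (index (x, false) w) (+) G (index (x, true) w).
  move=> xw; have xw' := xt x xw.
  rewrite -(chi_sum x xw) /G /F; have {chi_sum chi_end}E := chi_eq x xw.
  have [u1 [u2 [u3 [e [wE iE jE]]]]] := word_split uw xw xw'.
  have C ta tb := finger_parity_corner gw fn ta tb wE.
  rewrite /= iE jE -/h in C.
  move: (index _ w) (index _ w) E C; rewrite -/h; move: (parity_word w x) (h) (sgn x); clear.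
  move=> p h [] a c E C.
  - have [] := (E false false, E false true, E true false, E true true).
    rewrite /= !addn0 !addn1 => -[[E1 E2] E3] E4.
    have := (C false false, C false true, C true false, C true true).
    rewrite /= !addn0 !addn1 => -[[[C1 C2] C3] C4].
    rewrite !andb_addl {1}C1 {1}C3 {1}C2 {1}C4 !andb_addr {2}E1 {2}E2 {2}E3 {2}E4.
    rewrite addb8; congr (_ (+) _).
    exact: (etrans (addbACA _ _ _ _) (addbC _ _)).
  have [] := (E false false, E false true, E true false, E true true).
  rewrite /= !addn0 !addn1 => -[[E1 E2] E3] E4.
  have := (C false false, C false true, C true false, C true true).
  rewrite /= !addn0 !addn1 => -[[[C1 C2] C3] C4].
  rewrite !andb_addl {1}C2 {1}C4 {1}C1 {1}C3 !andb_addr {2}E1 {2}E2 {2}E3 {2}E4.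
  rewrite addb8; congr (_ (+) _).
  exact: (etrans (addbC _ _) (addbACA _ _ _ _)).
have : F 0%N (+) F (size w) = false.
  rewrite /F /h; case: chi_end => [[bC e]|[e e']].
    by rewrite !e !(potential_rot gw fn _ bC) addbb.
  by rewrite !e !e'.
rewrite -(big_addb_telescope F (leq0n _)) => S0.
(* The sum over the passages is rearranged as a sum over the crossings. *)
pose T := [seq z <- w | ~~ z.2]; pose flip (z : letter) := (z.1, ~~ z.2).
have uT : uniq T by rewrite filter_uniq.
have pw : perm_eq w (T ++ map flip T).
  have flipI : injective flip by move=> [? []] [? []] [->].
  apply: uniq_perm => //; first rewrite cat_uniq uT map_inj_uniq // uT /= andbT.
    apply/hasPn => _ /mapP[z zT ->]; apply/negP; move: zT; rewrite !mem_filter /= negbK.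
    by move=> /andP[/negbTE -> _].
  move=> [x e]; rewrite mem_cat !mem_filter /=; case: e => /=.
    apply/idP/mapP => [xw|[[y []]]]; last 2 first.
    - by rewrite mem_filter.
    - by rewrite mem_filter /= => yw [->]; apply: xt.
    exists (x, false) => //; rewrite mem_filter /=.
    by case/andP: gw => _ /allP a; apply: (a _ xw).
  by rewrite orb_idr // => /mapP[[y []]]; rewrite mem_filter.
have TE : \big[addb/false]_(z <- T) ((z.1 == x0) && parity_word w z.1) = false.
  rewrite -[RHS]S0 (eq_big_nat _ _ (F2 := fun i => G (index (nth (x0, false) w i) w))); last first.
    by move=> i /andP[_ iw]; rewrite index_uniq.
  rewrite -(big_nth (x0, false) xpredT (fun z => G (index z w))) (perm_big _ pw) /=.
  rewrite big_cat big_map /= -big_split big_seq [RHS]big_seq; apply: eq_bigr => -[x e] /=.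
  by rewrite mem_filter /=; case: e => //= xw; rewrite FE.
rewrite -TE (bigD1_seq (x0, false)) //=; last by rewrite mem_filter.
rewrite eqxx big_seq_cond big1 ?addbF // => -[x e]; rewrite mem_filter /= xpair_eqE.
by case: e => //= /andP[_ /negbTE]; rewrite eqxx andbT => ->.
Qed.
End WordParity.

(** * Vertical visibility in the plane *)
Section Plane.
Variable R : realFieldType.
Notation pt := (R * R)%type.
Implicit Types (p r a b z v y : pt).

(** Positive if [z] is on the left of the line from [p] to [r]. *)
Definition turn p r z : R := (r.1 - p.1) * (z.2 - p.2) - (r.2 - p.2) * (z.1 - p.1).

(** [z] is above the line through [p] and [r], whichever of them is on the
    left. *)
Definition over_line p r z : bool := 0 < (r.1 - p.1) * turn p r z.

(** The segment [a b] is strictly above [z].  The abscissas are compared as if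
    the vertical ray from [z] were slightly to the right of [z], so that a
    vertex above [z] counts for the segments that leave it to the right. *)
Definition shades a b z : bool :=
  ((a.1 <= z.1) != (b.1 <= z.1)) && ((b.1 - a.1) * turn a b z < 0).

(** Of two segments that leave [v] on the same side of the vertical, the one to
    [y] is above the one to [z]. *)
Definition branch_over v z y : bool := ((v.1 < y.1) == (v.1 < z.1)) && over_line v z y.

(** The half-open strip over [p r] agrees with the convention in [shades]. *)
Definition strip_over p r z : bool := [&& p.1 < z.1, z.1 <= r.1 & over_line p r z].

Definition along p r (s : R) : pt := (p.1 + s * (r.1 - p.1), p.2 + s * (r.2 - p.2)).

Definition apart p r a b := forall s t, 0 < s < 1 -> 0 <= t <= 1 -> along p r s <> along a b t.

Definition affine (f : R -> R) := forall X Y Z, (Y - X) * f Z = (Y - Z) * f X + (Z - X) * f Y.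

(** The intermediate value theorem, for affine functions. *)
Lemma affine_sign f X Y : affine f -> X <= Y -> (forall Z, X <= Z <= Y -> f Z != 0) ->
  (0 < f X) = (0 < f Y).
Proof.
move=> af XY nz.
have [<-//|neq] := eqVneq X Y; have {XY neq}XY : X < Y by rewrite lt_neqAle neq.
have nX : f X != 0 by apply: nz; rewrite lexx ltW.
have nY : f Y != 0 by apply: nz; rewrite lexx ltW.
have key : ~ (f X * f Y < 0).
  move=> neg; pose Z := (X * f Y - Y * f X) / (f Y - f X).
  have d : f Y - f X != 0 by apply/negP => /eqP e; nra.
  have ZE : Z * (f Y - f X) = X * f Y - Y * f X by rewrite /Z; field.
  have /eqP[] : f Z != 0.
    apply: nz; apply/andP; split.
      have : 0 <= (Z - X) * (f Y - f X) ^+ 2.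
        rewrite expr2 mulrA mulrBl ZE; nra.
      by rewrite pmulr_lge0 ?subr_ge0 // exprn_even_gt0.
    have : 0 <= (Y - Z) * (f Y - f X) ^+ 2.
      rewrite expr2 mulrA mulrBl ZE; nra.
    by rewrite pmulr_lge0 ?subr_ge0 // exprn_even_gt0.
  have := af X Y Z => E.
  have : (Y - X) * f Z * (f Y - f X) = 0.
    rewrite E; transitivity (Y * f X * (f Y - f X) - X * f Y * (f Y - f X)
      + (Z * (f Y - f X)) * (f Y - f X)); first by ring.
    by rewrite ZE; ring.
  by move/eqP; rewrite !mulf_eq0 (negbTE d) orbF subr_eq0 gt_eqF //= => /eqP.
by move: nX nY key; rewrite !neq_lt; do 2![case/orP => ?]; move=> key;
  apply/idP/idP => ?; try lra; exfalso; apply: key; nra.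
Qed.

Lemma addb_split (s1 s2 i1 i2 b1 b2 d : bool) : s1 (+) i1 (+) b1 = d -> s2 (+) i2 (+) b2 = d ->
  s1 (+) s2 = i1 (+) i2 (+) b1 (+) b2.
Proof. by case: s1 s2 i1 i2 b1 b2 d => [] [] [] [] [] [] []. Qed.

(** Over the abscissas common to [p r] and [a b], the difference [G] of the
    heights of the two lines is affine and does not vanish, except perhaps at a
    common end: its sign is constant.  The left end of these abscissas belongs
    to [p] or to [a], and there the sign shows as a shading of [p], as the
    position of [a] in the strip, or as a branch if [a = p].  The right end is
    similar, and the two expressions for the sign are equal. *)
Lemma shades_strip_lt p r a b : p.1 < r.1 -> a.1 < b.1 -> apart p r a b -> apart a b p r ->
  shades a b p (+) shades a b r =
    strip_over p r a (+) strip_over p r b (+) ((a == p) && branch_over p r b)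
    (+) ((b == r) && branch_over r p a).
Proof.
move=> pr ab ap1 ap2.
pose G X := (a.2 + (X - a.1) * (b.2 - a.2) / (b.1 - a.1))
          - (p.2 + (X - p.1) * (r.2 - p.2) / (r.1 - p.1)).
have dw : r.1 - p.1 != 0 by lra.
have dw' : b.1 - a.1 != 0 by lra.
have Gaf : affine G by move=> X Y Z; rewrite /G; field; rewrite dw dw'.
have w0 : 0 < r.1 - p.1 by lra.
have w0' : 0 < b.1 - a.1 by lra.
have oa : over_line p r a = (0 < G a.1).
  rewrite /over_line pmulr_rgt0 // (_ : turn p r a = (r.1 - p.1) * G a.1) ?pmulr_rgt0 //.
  by rewrite /turn /G; field; rewrite dw dw'.
have ob : over_line p r b = (0 < G b.1).
  rewrite /over_line pmulr_rgt0 // (_ : turn p r b = (r.1 - p.1) * G b.1) ?pmulr_rgt0 //.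
  by rewrite /turn /G; field; rewrite dw dw'.
have oa' : over_line r p a = (0 < G a.1).
  rewrite /over_line (_ : _ * turn r p a = ((r.1 - p.1) * (r.1 - p.1)) * G a.1) ?pmulr_rgt0 ?mulr_gt0 //.
  by rewrite /turn /G; field; rewrite dw dw'.
have up : ((b.1 - a.1) * turn a b p < 0) = (0 < G p.1).
  rewrite (_ : _ * turn a b p = - (((b.1 - a.1) * (b.1 - a.1)) * G p.1)).
    by rewrite oppr_lt0 pmulr_rgt0 ?mulr_gt0.
  by rewrite /turn /G; field; rewrite dw dw'.
have ur : ((b.1 - a.1) * turn a b r < 0) = (0 < G r.1).
  rewrite (_ : _ * turn a b r = - (((b.1 - a.1) * (b.1 - a.1)) * G r.1)).
    by rewrite oppr_lt0 pmulr_rgt0 ?mulr_gt0.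
  by rewrite /turn /G; field; rewrite dw dw'.
have meet X : G X = 0 -> along p r ((X - p.1) / (r.1 - p.1)) = along a b ((X - a.1) / (b.1 - a.1)).
  move=> GX; rewrite /along !divfK //; congr pair; first by lra.
  move: GX; rewrite /G => /eqP; rewrite subr_eq0 => /eqP GX.
  by rewrite mulrAC -GX mulrAC.
have par (X c d : R) : c < d -> (c <= X <= d -> 0 <= (X - c) / (d - c) <= 1) /\
      (c < X < d -> 0 < (X - c) / (d - c) < 1).
  move=> cd; have dc : 0 < d - c by lra.
  split=> /andP[h1 h2]; apply/andP; split.
  - by apply: divr_ge0; lra.
  - by rewrite ler_pdivrMr // mul1r; lra.
  - by apply: divr_gt0; lra.
  by rewrite ltr_pdivrMr // mul1r; lra.
have nz1 X : p.1 < X < r.1 -> a.1 <= X <= b.1 -> G X != 0.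
  move=> h1 h2; apply/eqP => /meet; apply: ap1; [exact: (par _ _ _ pr).2|exact: (par _ _ _ ab).1].
have nz2 X : a.1 < X < b.1 -> p.1 <= X <= r.1 -> G X != 0.
  move=> h1 h2; apply/eqP => /meet/esym; apply: ap2; [exact: (par _ _ _ ab).2|exact: (par _ _ _ pr).1].
have Gp : a.1 = p.1 -> (a == p) = (G p.1 == 0).
  move=> e; have -> : G p.1 = a.2 - p.2 by rewrite /G e !subrr !mul0r !addr0.
  by rewrite subr_eq0 [in LHS](surjective_pairing a) (surjective_pairing p) xpair_eqE e eqxx.
have Gr : b.1 = r.1 -> (b == r) = (G r.1 == 0).
  move=> e; have -> : G r.1 = b.2 - r.2.
    by rewrite /G -{1}e; field; rewrite ?dw' ?dw.
  by rewrite subr_eq0 [in LHS](surjective_pairing b) (surjective_pairing r) xpair_eqE e eqxx.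
rewrite /shades /strip_over /branch_over.
have neq1 (x y : pt) : x.1 != y.1 -> (x == y) = false.
  by move=> n; apply/negP => /eqP e; rewrite e eqxx in n.
rewrite {}up {}ur {}oa {}ob {}oa' {meet ap1 ap2 w0 w0' dw dw' par}.
clearbody G.
have lt_or (x y : R) : x <= y \/ y < x by case: (leP x y); [left|right].
have [bp|pb] := lt_or b.1 p.1.
  have -> : a.1 <= p.1 by lra.
  have -> : a.1 <= r.1 by lra.
  have -> : b.1 <= r.1 by lra.
  have -> : (p.1 < a.1) = false by apply/negbTE; rewrite -leNgt; lra.
  rewrite (neq1 b r); last by rewrite lt_eqF //; lra.
  have -> : (p.1 < b.1) = false by apply/negbTE; rewrite -leNgt.
  by rewrite bp pr /= !andbF.
have [ra|ar] := lt_or r.1 a.1.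
  have -> : (a.1 <= p.1) = false by apply/negbTE; rewrite -ltNge; lra.
  have -> : (b.1 <= p.1) = false by apply/negbTE; rewrite -ltNge; lra.
  have -> : (b.1 <= r.1) = false by apply/negbTE; rewrite -ltNge; lra.
  rewrite (neq1 b r); last by rewrite gt_eqF //; lra.
  rewrite (neq1 a p); last by rewrite gt_eqF //; lra.
  have -> : p.1 < a.1 by lra.
  move: ra; rewrite le_eqVlt => /orP[/eqP ra|ra].
    by rewrite -ra lexx pb /= !addbF.
  by rewrite leNgt ra /= andbF.
pose lo := Num.max a.1 p.1; pose hi := Num.min b.1 r.1; pose mid := (lo + hi) / 2.
have [alo plo] : a.1 <= lo /\ p.1 <= lo by rewrite /lo !le_max !lexx orbT.
have [bhi rhi] : hi <= b.1 /\ hi <= r.1 by rewrite /hi !ge_min !lexx orbT.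
have lohi : lo < hi by rewrite /lo /hi lt_min !gt_max ab pb ar pr.
have [lom mhi] : lo < mid /\ mid < hi by rewrite /mid; lra.
set S1 := (_ && (0 < G p.1)); set S2 := (_ && (0 < G r.1)).
set I1 := [&& _, _ & (0 < G a.1)]; set I2 := [&& _, _ & (0 < G b.1)].
set B1 := ((a == p) && _); set B2 := ((b == r) && _).
have EL : S1 (+) I1 (+) B1 = (0 < G mid).
  rewrite /S1 /I1 /B1.
  have -> : (b.1 <= p.1) = false by apply/negbTE; rewrite -ltNge.
  rewrite pb pr (ltW ar).
  have [apl|apl|apl] := ltgtP a.1 p.1 => /=.
  - rewrite neq1 ?lt_eqF //= !addbF; apply: affine_sign => // [|Z /andP[h1 h2]]; first lra.
    by apply: nz2; apply/andP; split; lra.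
  - rewrite neq1 ?gt_eqF //= !addbF; apply: affine_sign => // [|Z /andP[h1 h2]]; first lra.
    by apply: nz1; apply/andP; split; lra.
  rewrite Gp // addbF; have [G0|G0] := eqVneq (G p.1) 0; rewrite /= ?addbF.
    rewrite G0 ltxx /=.
    have := Gaf p.1 b.1 mid; rewrite G0 mulr0 add0r => E.
    have b1 : 0 < b.1 - p.1 by lra.
    have b2 : 0 < mid - p.1 by lra.
    by rewrite -(pmulr_rgt0 _ b2) -E pmulr_rgt0.
  apply: affine_sign => // [|Z /andP[h1 h2]]; first lra.
  have [<-//|zp] := eqVneq p.1 Z; have {}zp : p.1 < Z by rewrite lt_neqAle zp.
  by apply: nz1; apply/andP; split; lra.
have ER : S2 (+) I2 (+) B2 = (0 < G mid).
  rewrite /S2 /I2 /B2.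
  have -> : (r.1 < a.1) = false by apply/negbTE; rewrite -leNgt ltW.
  have -> : (r.1 < p.1) = false by apply/negbTE; rewrite -leNgt ltW.
  rewrite pb (ltW ar).
  have [apl|apl|apl] := ltgtP b.1 r.1 => /=.
  - rewrite neq1 ?lt_eqF //= !addbF; symmetry.
    apply: affine_sign => // [|Z /andP[h1 h2]]; first lra.
    by apply: nz1; apply/andP; split; lra.
  - rewrite neq1 ?gt_eqF //= !addbF; symmetry.
    apply: affine_sign => // [|Z /andP[h1 h2]]; first lra.
    by apply: nz2; apply/andP; split; lra.
  rewrite Gr // apl; have [G0|G0] := eqVneq (G r.1) 0; rewrite /= ?addbF.
    rewrite G0 ltxx /=.
    have := Gaf a.1 r.1 mid; rewrite G0 mulr0 addr0 => E.
    have b1 : 0 < r.1 - a.1 by lra.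
    have b2 : 0 < r.1 - mid by lra.
    by rewrite -(pmulr_rgt0 _ b2) -E pmulr_rgt0.
  symmetry; apply: affine_sign => // [|Z /andP[h1 h2]]; first lra.
  have [->//|zp] := eqVneq Z r.1; have {}zp : Z < r.1 by rewrite lt_neqAle zp.
  by apply: nz1; apply/andP; split; lra.
exact: addb_split EL ER.
Qed.

Lemma turn_start p r : turn p r p = 0.
Proof. by rewrite /turn !subrr !mulr0 subrr. Qed.

Lemma turn_end p r : turn p r r = 0.
Proof. by rewrite /turn mulrC subrr. Qed.

Lemma shadesC a b z : shades a b z = shades b a z.
Proof.
rewrite /shades; congr andb; first by rewrite eq_sym.
by congr (_ < 0); rewrite /turn; ring.
Qed.

Lemma along_rev p r s : along p r s = along r p (1 - s).
Proof. by rewrite /along; congr pair; ring. Qed.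

(** Along the segment [p r], the shading by [a b] changes only where an end of
    [a b] is passed above; if this end is [p] or [r] itself, then [a b] is a
    branch there. *)
Lemma shades_strip p r a b : p.1 < r.1 -> a.1 != b.1 ->
  (apart p r a b /\ apart a b p r) \/ (a = p /\ b = r) \/ (a = r /\ b = p) ->
  shades a b p (+) shades a b r =
    strip_over p r a (+) strip_over p r b
    (+) (((a == p) && branch_over p r b) (+) ((b == p) && branch_over p r a))
    (+) (((a == r) && branch_over r p b) (+) ((b == r) && branch_over r p a)).
Proof.
move=> pr ab H; have rp : (r.1 < p.1) = false by apply/negbTE; rewrite -leNgt ltW.
case: H => [[ap1 ap2]|H]; last first.
  have z1 u v : ((v.1 - u.1) * turn u v u < 0) = false by rewrite turn_start mulr0 ltxx.
  have z2 u v : ((v.1 - u.1) * turn u v v < 0) = false by rewrite turn_end mulr0 ltxx.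
  have o1 u v : over_line u v u = false by rewrite /over_line turn_start mulr0 ltxx.
  have o2 u v : over_line u v v = false by rewrite /over_line turn_end mulr0 ltxx.
  by case: H => -[-> ->]; rewrite /shades /strip_over /branch_over !z1 !z2 !o1 !o2 !andbF.
have extra u v : u.1 < v.1 -> ((v == p) && branch_over p r u) = false /\
    ((u == r) && branch_over r p v) = false.
  move=> uv; split; apply/negP => /andP[/eqP e /andP[]].
    by rewrite pr -e ltNge (ltW uv).
  by rewrite rp -e uv.
move: ab; rewrite neq_lt => /orP[ab|ba].
  have [-> ->] := extra _ _ ab; rewrite addbF addFb.
  by rewrite shades_strip_lt.
have [-> ->] := extra _ _ ba; rewrite addbF addFb.
have flip u v x y : apart u v x y -> apart u v y x.
  by move=> A s t s01 /andP[t0 t1]; rewrite (along_rev y); apply: A => //; apply/andP; split; lra.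
have flip' u v x y : apart u v x y -> apart v u x y.
  by move=> A s t /andP[s0 s1] t01; rewrite (along_rev v); apply: A => //; apply/andP; split; lra.
rewrite ![shades a b _]shadesC shades_strip_lt //; [|exact: flip|exact: flip'].
by rewrite [strip_over p r b (+) _]addbC.
Qed.

Lemma branch_over_self v z : branch_over v z z = false.
Proof. by rewrite /branch_over /over_line turn_end mulr0 ltxx andbF. Qed.

Lemma turnC v y z : turn v y z = - turn v z y.
Proof. by rewrite /turn; ring. Qed.

Lemma branch_over_pair v y z : v.1 != y.1 -> v.1 != z.1 ->
  (turn v y z = 0 -> (v.1 < y.1) != (v.1 < z.1)) ->
  branch_over v y z (+) branch_over v z y = ((v.1 < z.1) == (v.1 < y.1)).
Proof.
move=> vy vz nt; rewrite /branch_over [(v.1 < y.1) == _]eq_sym /over_line (turnC v z y).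
have [side|] /= := eqVneq (v.1 < z.1) (v.1 < y.1); last by [].
have t0 : turn v y z != 0 by apply/eqP => /nt; rewrite side eqxx.
have [y0 z0] : y.1 - v.1 != 0 /\ z.1 - v.1 != 0 by rewrite !subr_eq0 ![_ == v.1]eq_sym.
have same : 0 < (y.1 - v.1) * (z.1 - v.1).
  move: vy vz side; rewrite !neq_lt => /orP[h|h] /orP[h'|h']; rewrite ?h ?h' ?(lt_gtF h) ?(lt_gtF h') // => _.
    by apply: mulr_gt0; lra.
  by rewrite nmulr_rgt0; lra.
have : 0 != (y.1 - v.1) * turn v y z by rewrite eq_sym mulf_neq0.
rewrite neq_lt => /orP[pos|neg]; rewrite ?pos ?(lt_gtF neg) /=; last first.
  suff -> : 0 < (z.1 - v.1) * - turn v y z by [].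
  have : 0 < ((y.1 - v.1) * (z.1 - v.1)) * - ((y.1 - v.1) * turn v y z) by apply: mulr_gt0; lra.
  rewrite (_ : _ * _ = ((y.1 - v.1) * (y.1 - v.1)) * ((z.1 - v.1) * - turn v y z)); last by ring.
  by rewrite pmulr_rgt0 // lt0r mulf_neq0 // -expr2 sqr_ge0.
suff -> : 0 < (z.1 - v.1) * - turn v y z = false by [].
apply/negbTE; rewrite -leNgt ltW //.
have : ((y.1 - v.1) * (z.1 - v.1)) * - ((y.1 - v.1) * turn v y z) < 0 by rewrite pmulr_rlt0; lra.
rewrite (_ : _ * _ = ((y.1 - v.1) * (y.1 - v.1)) * ((z.1 - v.1) * - turn v y z)); last by ring.
by rewrite pmulr_rlt0 // lt0r mulf_neq0 // -expr2 sqr_ge0.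
Qed.

(** Two collinear segments that leave [v] on the same side would overlap. *)
Lemma turn_neq0 i v o : v.1 != i.1 -> v.1 != o.1 -> (v.1 < i.1) = (v.1 < o.1) ->
  apart v o i v -> turn v i o <> 0.
Proof.
move=> vi vo side ap t0.
have [i0 o0] : i.1 - v.1 != 0 /\ o.1 - v.1 != 0 by rewrite !subr_eq0 ![_ == v.1]eq_sym.
have mu0 : 0 < (i.1 - v.1) / (o.1 - v.1).
  move: vi vo side; rewrite !neq_lt => /orP[h|h] /orP[h'|h']; rewrite ?h ?h' ?(lt_gtF h) ?(lt_gtF h') // => _.
    by apply: divr_gt0; lra.
  by rewrite -mulrNN -invrN; apply: divr_gt0; rewrite oppr_gt0 subr_lt0.
set mu := _ / _ in mu0; have muE : i.1 - v.1 = mu * (o.1 - v.1) by rewrite /mu divfK.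
have mu1 : 1 + mu != 0 by lra.
have muE2 : i.2 - v.2 = mu * (o.2 - v.2).
  apply: (mulfI o0); transitivity ((i.1 - v.1) * (o.2 - v.2)); last by rewrite muE; ring.
  by move/eqP: t0; rewrite /turn subr_eq0 => /eqP ->; rewrite mulrC.
have s1 : 0 < mu / (1 + mu) < 1.
  by apply/andP; split; [apply: divr_gt0|rewrite ltr_pdivrMr]; lra.
apply: (ap (mu / (1 + mu)) (mu / (1 + mu)) s1); first by case/andP: s1 => *; rewrite !ltW.
rewrite /along; congr pair.
  rewrite (_ : i.1 = v.1 + mu * (o.1 - v.1)); last by rewrite -muE; ring.
  by field.
rewrite (_ : i.2 = v.2 + mu * (o.2 - v.2)); last by rewrite -muE2; ring.
by field.
Qed.

Definition opposite v y z := exists2 m : R, 0 < m &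
  z.1 - v.1 = - (m * (y.1 - v.1)) /\ z.2 - v.2 = - (m * (y.2 - v.2)).

(** At a transverse crossing the half-edges in directions [y] and [z] determine
    the opposite ones [i] and [o]; the side of the vertical on which [y] and [z]
    lie and the orientation of the crossing decide which half-edge is above
    which. *)
Lemma branch_over_crossing v y z i o : v.1 != y.1 -> v.1 != z.1 ->
  opposite v y i -> opposite v z o -> turn v y z != 0 ->
  [/\ branch_over v y z = ((v.1 < z.1) == (v.1 < y.1)) && ((v.1 < y.1) == (0 < turn v y z)),
     branch_over v y o = ((v.1 < z.1) != (v.1 < y.1)) && ((v.1 < y.1) != (0 < turn v y z)),
     branch_over v y i = false &
     (v.1 < i.1) = ~~ (v.1 < y.1)].
Proof.
move=> vy vz [m m0 [i1 i2]] [n n0 [o1 o2]] t0.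
have [m0' n0'] : m != 0 /\ n != 0 by rewrite !gt_eqF.
have sgnE (u w : R) : u != 0 -> w != 0 -> (0 < u * w) = ((0 < u) == (0 < w)).
  rewrite !neq_lt => /orP[h|h] /orP[h'|h'].
  - by rewrite nmulr_rgt0 // h' (lt_gtF h) (lt_gtF h').
  - by rewrite nmulr_rgt0 // (lt_gtF h) (lt_gtF h') h'.
  - by rewrite pmulr_rgt0 // h (lt_gtF h').
  by rewrite pmulr_rgt0 // h h'.
have gt (u : pt) : (v.1 < u.1) = (0 < u.1 - v.1) by rewrite subr_gt0.
have y0 : y.1 - v.1 != 0 by rewrite subr_eq0 eq_sym.
have z0 : z.1 - v.1 != 0 by rewrite subr_eq0 eq_sym.
have oppE (u : R) : u != 0 -> (0 < - u) = ~~ (0 < u).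
  by move=> u0; rewrite oppr_gt0 -leNgt le_eqVlt (negbTE u0).
have vo : (v.1 < o.1) = ~~ (v.1 < z.1).
  by rewrite !gt o1 oppE ?mulf_neq0 // pmulr_rgt0.
have vi : (v.1 < i.1) = ~~ (v.1 < y.1).
  by rewrite !gt i1 oppE ?mulf_neq0 // pmulr_rgt0.
split=> //.
- by rewrite /branch_over /over_line sgnE // -gt.
- rewrite /branch_over /over_line vo.
  have -> : turn v y o = - (n * turn v y z) by rewrite /turn o1 o2; ring.
  rewrite sgnE ?oppr_eq0 ?mulf_neq0 // -gt oppE ?mulf_neq0 // pmulr_rgt0 //.
  by case: (v.1 < z.1) (v.1 < y.1) (0 < turn v y z) => [] [] [].
by rewrite /branch_over vi; case: (v.1 < y.1).
Qed.

Lemma oppositeC v y z : opposite v y z -> opposite v z y.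
Proof.
move=> [m m0 [e1 e2]]; exists m^-1; first by rewrite invr_gt0.
by rewrite e1 e2 -!mulrN !opprK !mulKf ?gt_eqF.
Qed.

(** * Colouring the sides of a walk by a closed loop *)
Section Walk.
Variables (q : nat -> pt) (M a c : nat).
Hypothesis q_steep : forall k, (k < M)%N -> (q k).1 != (q k.+1).1.
Hypothesis q_apart : forall k l, (k < M)%N -> (l < M)%N -> k <> l ->
  apart (q k) (q k.+1) (q l) (q l.+1).
Hypotheses (ac : (a < c)%N) (cM : (c <= M)%N) (q_loop : q a = q c).

(** The loop is the part of the walk [q] between the indices [a] and [c].  A
    point off the loop has the colour of the number of segments of the loop
    above it, modulo 2. *)
Definition depth z := \big[addb/false]_(a <= l < c) shades (q l) (q l.+1) z.

(** The segments of the loop with an end at [v] that are above the direction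
    [z]: they shade the points that follow [v] in this direction, but not [v]
    itself. *)
Definition branches v z := \big[addb/false]_(a <= l < c)
  (((q l == v) && branch_over v z (q l.+1)) (+) ((q l.+1 == v) && branch_over v z (q l))).

Definition on_loop k := (a <= k < c)%N.

Lemma on_loop_step j :
  on_loop j (+) on_loop j.+1 = (j.+1 == a) (+) (j.+1 == c).
Proof. by rewrite /on_loop; clear -ac; lia. Qed.

(** The colour just above the start of segment [k]. *)
Definition top_colour k := depth (q k) (+) branches (q k) (q k.+1).

(** The left side is the lower side when the walk goes leftwards, and the colours
    above and below a segment differ exactly if the segment is on the loop. *)
Definition left_colour k := top_colour k (+) (((q k.+1).1 < (q k).1) && on_loop k).

(** The colour above a segment is the same at its two ends.  By [shades_strip],
    the change for one segment of the loop comes from the ends of that segment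
    that are above the strip; each vertex of the closed loop is such an end for
    two segments. *)
Lemma depth_branches k p r : (k < M)%N -> p.1 < r.1 ->
  (q k = p /\ q k.+1 = r) \/ (q k = r /\ q k.+1 = p) ->
  depth p (+) branches p r = depth r (+) branches r p.
Proof.
move=> kM pr qk.
suff : depth p (+) depth r = branches p r (+) branches r p.
  by case: (depth p) (depth r) (branches p r) (branches r p) => [] [] [] [].
have tel : \big[addb/false]_(a <= l < c) (strip_over p r (q l) (+) strip_over p r (q l.+1)) = false.
  by rewrite (big_addb_telescope (fun l => strip_over p r (q l))) ?(ltnW ac) // q_loop addbb.
rewrite /depth /branches -!big_split /=.
rewrite -[RHS]addFb -[X in _ = X (+) _]tel -!big_split /=; apply: eq_big_nat => l /andP[al lc].
have lM : (l < M)%N by apply: leq_trans cM.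
rewrite (shades_strip pr (q_steep lM)); last first.
  have [->|/eqP kl] := eqVneq l k.
    by right; case: qk => -[-> ->]; [left|right].
  left; case: qk => -[<- <-]; first by split; apply: q_apart => //; apply/nesym.
  have flip u v x y : apart u v x y -> apart u v y x.
    by move=> A s t s01 /andP[t0 t1]; rewrite (along_rev y); apply: A => //; apply/andP; split; lra.
  have flip' u v x y : apart u v x y -> apart v u x y.
    by move=> A s t /andP[s0 s1] t01; rewrite (along_rev v); apply: A => //; apply/andP; split; lra.
  by split; [apply: flip'|apply: flip]; apply: q_apart => //; apply/nesym.
exact: esym (addbA _ _ _).
Qed.

Lemma top_colourE k : (k < M)%N ->
  top_colour k = depth (q k.+1) (+) branches (q k.+1) (q k).
Proof.
move=> kM; have := q_steep kM; rewrite neq_lt => /orP[lt|lt].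
  by apply: (depth_branches kM lt); left.
by symmetry; apply: (depth_branches kM lt); right.
Qed.

Lemma big_addb_mem (ks : seq nat) (f : nat -> bool) : uniq ks ->
  \big[addb/false]_(a <= l < c) ((l \in ks) && f l) =
  \big[addb/false]_(k <- ks) (on_loop k && f k).
Proof.
elim: ks => [_|k ks IH /= /andP[kks uks]]; first by rewrite big_nil big1_eq.
rewrite big_cons -IH //.
rewrite (eq_bigr (fun l => ((l == k) && f l) (+) ((l \in ks) && f l))); last first.
  move=> l _; rewrite inE; have [->|_] //= := eqVneq l k.
  by rewrite (negbTE kks) /= addbF.
rewrite big_split /=; congr addb.
have [kac|kac] := boolP (on_loop k).
  rewrite (bigD1_seq k) ?iota_uniq ?mem_index_iota //= eqxx big1 ?addbF //.
  by move=> l /negbTE ->.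
rewrite big_nat_cond big1 // => l /andP[lac _]; apply/negbTE/nandP; left.
by apply: contraNneq kac => <-.
Qed.

(** Here [ks] lists the indices that precede the visits of the walk at [v], and
    the half-edges at [v] are grouped by visits. *)
Lemma branchesE v z (ks : seq nat) : uniq ks -> (0 < c)%N ->
  (forall l, (l <= M)%N -> (q l == v) = (l \in map succn ks)) ->
  branches v z = \big[addb/false]_(j <- ks)
    ((on_loop j.+1 && branch_over v z (q j.+2)) (+) (on_loop j && branch_over v z (q j))).
Proof.
move=> uks c0 occ; rewrite /branches big_split [RHS]big_split /=; congr addb.
  rewrite -(big_map succn xpredT (fun k => on_loop k && branch_over v z (q k.+1))).
  rewrite -big_addb_mem ?map_inj_uniq //; last exact: succn_inj.
  apply: eq_big_nat => l /andP[_ lc]; rewrite occ //.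
  by apply: leq_trans cM; apply: ltnW.
rewrite -big_addb_mem //; apply: eq_big_nat => l /andP[_ lc].
rewrite occ ?mem_map //; first exact: succn_inj.
exact: leq_trans lc cM.
Qed.

Lemma left_colour_pred j : (j < M)%N -> left_colour j =
  depth (q j.+1) (+) branches (q j.+1) (q j) (+) (((q j.+1).1 < (q j).1) && on_loop j).
Proof. by move=> jM; rewrite /left_colour top_colourE. Qed.

(** Where the walk passes alone, its left side before and after the vertex is
    in one region. *)
Lemma left_colour_vertex j : (j.+1 < M)%N ->
  (forall l, (l <= M)%N -> (q l == q j.+1) = (l == j.+1)) -> on_loop j = on_loop j.+1 ->
  left_colour j.+1 = left_colour j.
Proof.
move=> jM occ same; have jM' := ltnW jM.
rewrite (left_colour_pred jM') /left_colour /top_colour.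
have c0 : (0 < c)%N by apply: leq_ltn_trans ac.
have occ' l : (l <= M)%N -> (q l == q j.+1) = (l \in map succn [:: j]) by rewrite inE; apply: occ.
rewrite !(branchesE _ (ks := [:: j]) isT c0 occ') !big_seq1 !branch_over_self same.
set v := q j.+1; set i := q j; set o := q j.+2.
have vi : v.1 != i.1 by rewrite eq_sym; apply: q_steep.
have vo : v.1 != o.1 by apply: q_steep.
have pair : branch_over v i o (+) branch_over v o i = ((v.1 < o.1) == (v.1 < i.1)).
  apply: branch_over_pair => // t0; apply/eqP => side; apply: (turn_neq0 vi vo side _ t0).
  by apply: q_apart => //; lia.
have ov : (o.1 < v.1) = ~~ (v.1 < o.1) by rewrite -leNgt le_eqVlt eq_sym (negbTE vo).
rewrite ov -/v; move: pair; move: (branch_over v i o) (branch_over v o i) (v.1 < o.1) (v.1 < i.1).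
by move: (depth _) (on_loop _); clear; do 6!case.
Qed.

(** Each of the four corners at a crossing is in one region, seen from either
    strand.  The two visits are [j.+1] and [j'.+1], and [col k t] is the colour
    on the right of segment [k] if [t] holds, on the left otherwise.  The loop
    has an even number of half-edges at the crossing.  The cases left at the end
    are the positions of the half-edges with respect to the vertical. *)
Lemma left_colour_crossing j j' ta tb : (j.+1 < M)%N -> (j'.+1 < M)%N ->
  j != j' -> q j'.+1 = q j.+1 ->
  (forall l, (l <= M)%N -> (q l == q j.+1) = (l == j.+1) || (l == j'.+1)) ->
  opposite (q j.+1) (q j.+2) (q j) -> opposite (q j.+1) (q j'.+2) (q j') ->
  turn (q j.+1) (q j.+2) (q j'.+2) != 0 ->
  on_loop j (+) on_loop j.+1 (+) (on_loop j' (+) on_loop j'.+1) = false ->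
  let E := 0 < turn (q j.+1) (q j.+2) (q j'.+2) in
  let col k t := left_colour k (+) (t && on_loop k) in
  (if tb (+) ~~ E then col j.+1 ta else col j ta) =
  (if ta (+) E then col j'.+1 tb else col j' tb).
Proof.
move=> jM j'M jj' vE occ op op' t0 even E col.
have c0 : (0 < c)%N by apply: leq_ltn_trans ac.
have occ' l : (l <= M)%N -> (q l == q j.+1) = (l \in map succn [:: j; j']).
  by rewrite !inE; apply: occ.
have u : uniq [:: j; j'] by rewrite /= inE jj'.
rewrite /col ![left_colour j]left_colour_pred ?[left_colour j']left_colour_pred ?(ltnW jM) ?(ltnW j'M) //.
rewrite /left_colour /top_colour vE !(branchesE _ u c0 occ') !big_cons !big_nil.
have vo : (q j.+1).1 != (q j.+2).1 by apply: q_steep.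
have vo' : (q j.+1).1 != (q j'.+2).1 by rewrite -vE; apply: q_steep.
have vi : (q j.+1).1 != (q j).1 by rewrite eq_sym; apply: q_steep; apply: ltnW.
have vi' : (q j.+1).1 != (q j').1 by rewrite -vE eq_sym; apply: q_steep; apply: ltnW.
rewrite !branch_over_self.
have sgnE' (x : R) : x != 0 -> (0 < - x) = ~~ (0 < x).
  by move=> u0; rewrite oppr_gt0 -leNgt le_eqVlt (negbTE u0).
have gtE (x y : pt) : x.1 != y.1 -> (y.1 < x.1) = ~~ (x.1 < y.1).
  by move=> n; rewrite -leNgt le_eqVlt eq_sym (negbTE n).
have [iop iop'] := (oppositeC op, oppositeC op').
case: (op) => m m0 [i1 i2]; case: (op') => n n0 [i1' i2'].
have [m0' n0'] : m != 0 /\ n != 0 by rewrite !gt_eqF.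
have t1 : turn (q j.+1) (q j) (q j'.+2) = - (m * turn (q j.+1) (q j.+2) (q j'.+2)).
  by rewrite /turn i1 i2; ring.
have t2 : turn (q j.+1) (q j'.+2) (q j.+2) = - turn (q j.+1) (q j.+2) (q j'.+2).
  exact: turnC.
have t3 : turn (q j.+1) (q j') (q j.+2) = n * turn (q j.+1) (q j.+2) (q j'.+2).
  by rewrite /turn i1' i2'; ring.
have nz1 : turn (q j.+1) (q j) (q j'.+2) != 0 by rewrite t1 oppr_eq0 mulf_neq0.
have nz2 : turn (q j.+1) (q j'.+2) (q j.+2) != 0 by rewrite t2 oppr_eq0.
have nz3 : turn (q j.+1) (q j') (q j.+2) != 0 by rewrite t3 mulf_neq0.
have [-> -> -> s1] := branch_over_crossing vo vo' op op' t0.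
have [-> -> -> _] := branch_over_crossing vi vo' iop op' nz1.
have [-> -> -> s2] := branch_over_crossing vo' vo op' op nz2.
have [-> -> -> _] := branch_over_crossing vi' vo iop' op nz3.
rewrite t1 t2 t3 !sgnE' ?mulf_neq0 // !pmulr_rgt0 // -/E.
rewrite !s1 !s2 (gtE _ _ vo) (gtE _ _ vo').
move: even; clearbody E; move: (_ < _) (_ < _) (depth _) (on_loop j) (on_loop j.+1) (on_loop j') (on_loop j'.+1).
clear=> s s' d g1 g2 g3 g4.
by case: g1 g2 g3 g4 => [] [] [] [] //; case: s s' E ta tb d => [] [] [] [] [] [].
Qed.

End Walk.
End Plane.

(** * Polygonal knots as walks *)
Section Shear.
Variable R : realFieldType.

Definition shear (d : R) (p : R * R) : R * R := (p.1 + d * p.2, p.2).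

(** A nonzero vector becomes vertical for one value of [d] at most, and this
    value is not small unless it is zero. *)
Lemma generic_shear (us : seq (R * R)) : exists2 d, 0 < d & forall u, u \in us ->
  (0 < u.1 -> 0 < (shear d u).1) /\ (u != 0 -> (shear d u).1 != 0).
Proof.
suff [e e0 H] : exists2 e, 0 < e & forall d, 0 < d < e -> forall u, u \in us ->
    (0 < u.1 -> 0 < (shear d u).1) /\ (u != 0 -> (shear d u).1 != 0).
  by exists (e / 2); [lra|apply: H; lra].
elim: us => [|u us [e e0 IH]]; first by exists 1.
have [u1|u1] := eqVneq u.1 0.
  exists e => // d de v; rewrite inE => /orP[/eqP->|]; last exact: IH.
  split; rewrite /shear /= u1 ?ltxx // add0r => u0.
  rewrite mulf_neq0 //; first by rewrite gt_eqF //; lra.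
  by apply: contraNneq u0 => u2; rewrite [u]surjective_pairing u1 u2.
have k0 : 0 < `|u.1| / (1 + `|u.2|).
  by rewrite divr_gt0 ?normr_gt0 // ltr_pwDl.
exists (Num.min e (`|u.1| / (1 + `|u.2|))); first by rewrite lt_min e0.
move=> d /andP[d0]; rewrite lt_min => /andP[de dk] v; rewrite inE => /orP[/eqP->|]; last first.
  by apply: IH; rewrite d0.
have {dk}small : `|d * u.2| < `|u.1|.
  rewrite ltr_pdivlMr ?ltr_pwDl // in dk.
  rewrite normrM (gtr0_norm d0); apply: le_lt_trans dk.
  by rewrite ler_pM2l // ler_wpDl.
split; rewrite /shear /=.
  by move=> up; move: small; rewrite (gtr0_norm up) ltr_norml; lra.
move=> _; apply/eqP => /eqP; rewrite addr_eq0 => /eqP e1.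
by move: small; rewrite e1 normrN ltxx.
Qed.

End Shear.

Section Knot.
Variables (R : realType) (b : base) (K : knot_data R).
Hypothesis dK : knot_diagram b K.
Notation n := (nedges b K).
Notation crossing := (crossing b K).
Notation is_param := (is_param b K).
Notation point := (point K).
Notation vx := (vertex K).
Notation edge := (edge K).
Notation param := (param R).

Lemma nedges_gt0 : (0 < n)%N.
Proof.
case: dK => + _ _ _; rewrite /nedges; case: b => [|/eqP]; last first.
  by rewrite -size_eq0 lt0n.
by move=> [+ _ _ _]; case: (_.-1) => //; rewrite ltxx.
Qed.

Lemma nedges_size : (n <= size (vertices K))%N.
Proof. by rewrite /nedges; case: b => //; apply: leq_pred. Qed.

Lemma point_end i : point (i, 1) = vx (i.+1 %% size (vertices K)).
Proof. by rewrite /Defs.point /Defs.edge /= !mul1r !subrKC -surjective_pairing. Qed.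

Lemma point_start i : point (i, 0) = vx i.
Proof. by rewrite /Defs.point /= !mul0r !addr0 -surjective_pairing. Qed.

Lemma line_bounds : b = Line -> forall i, (i <= n)%N ->
  ((0 < i)%N -> (vx 0).1 < (vx i).1) /\ ((i < n)%N -> (vx i).1 < (vx n).1).
Proof.
have n0 := nedges_gt0.
move: dK n0 => [+ _ _ _]; rewrite /nedges; case: b => // -[v0n _ _ inner] n0 _ i.
rewrite leq_eqVlt => /orP[/eqP->|ilt]; first by rewrite ltnn.
case: i ilt => [|i] ilt; first by split.
by have /andP[] := inner i.+1 ilt.
Qed.

Lemma line_mod : b = Line -> forall i, (i <= n)%N -> (i %% size (vertices K))%N = i.
Proof.
move=> bL i iN; rewrite modn_small //; have := nedges_gt0; move: iN; rewrite /nedges bL.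
by case: (size _) => // k /=; lia.
Qed.

Lemma point_before_end x : b = Line -> is_param x -> (point x).1 < (vx n).1.
Proof.
move=> bL /andP[xn /andP[x0 x1]]; rewrite /Defs.point /Defs.edge /= line_mod //.
have [_ /(_ xn) h1] := line_bounds bL (ltnW xn).
have h2 : (vx x.1.+1).1 <= (vx n).1.
  have [->//|xn'] := eqVneq x.1.+1 n.
  by apply/ltW; apply: (line_bounds bL xn).2; rewrite ltn_neqAle xn' xn.
nra.
Qed.

Lemma crossing_spec x y : crossing x y ->
  [/\ 0 < x.2, 0 < y.2 & det (edge x.1) (edge y.1) != 0].
Proof. by case: dK => _ + _ _; apply. Qed.

Lemma crossing_sym x y : crossing x y -> crossing y x.
Proof. by case=> ? ? ? ?; split=> //; apply: nesym. Qed.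

(** The closed edges meet [x] at [x] only.  The end of an edge, [t = 1], is the
    start of another one, and crossings do not occur at starts of edges; or it
    is the end of the line, which is to the right of all other points. *)
Lemma not_crossed x j t : is_param x -> 0 < x.2 -> (forall y, ~ crossing x y) ->
  (j < n)%N -> 0 <= t <= 1 -> (j, t) <> x -> point (j, t) <> point x.
Proof.
move=> px x0 nc jn /andP[t0 t1] neq e; move: t1; rewrite le_eqVlt => /orP[/eqP t1|t1]; last first.
  apply: (nc (j, t)); split=> //; last by apply: nesym.
  by rewrite /Defs.is_param /= jn t0 t1.
move: e; rewrite t1 point_end; set i := (_ %% _)%N => e.
have [iN|iN] := ltnP i n.
  have cr : crossing x (i, 0).
    split=> //; first by rewrite /Defs.is_param /= iN lexx ltr01.
      by move=> xi; rewrite xi /= ltxx in x0.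
    by rewrite point_start.
  by have [_ /=] := crossing_spec cr; rewrite ltxx.
case bE : b; last first.
  have nE : n = size (vertices K) by rewrite /nedges bE.
  by move: iN; rewrite leqNgt nE ltn_pmod // -nE nedges_gt0.
have iE : i = j.+1 by rewrite /i line_mod.
have ijn : i = n by apply/eqP; rewrite eqn_leq iN iE jn.
by have := point_before_end bE px; rewrite -e ijn ltxx.
Qed.

(** All points of a constant edge would be crossings, even its start. *)
Lemma edge_neq0 i : (i < n)%N -> edge i != 0.
Proof.
move=> iN; apply/eqP => e0.
have cr : crossing (i, 0) (i, 2^-1).
  split; rewrite /Defs.is_param /= ?iN //; first by rewrite lexx ltr01.
  - by rewrite invr_ge0 ler0n invf_lt1 ?ltr1n ?ltr0n.
  - by move=> [] /eqP; rewrite eq_sym invr_eq0 pnatr_eq0.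
  by rewrite /Defs.point e0 /= !mulr0.
by have [/=] := crossing_spec cr; rewrite ltxx.
Qed.

Definition place (x : param) : R := x.1%:R + x.2.

Lemma place_lt x y : is_param x -> is_param y -> (place x < place y) = param_lt x y.
Proof.
move=> /andP[_ /andP[x0 x1]] /andP[_ /andP[y0 y1]]; rewrite /place /param_lt.
case: ltngtP => [lt|gt|<-] /=; last by rewrite ltrD2l.
  have h : x.1%:R + 1 <= y.1%:R :> R by rewrite natr1 ler_nat.
  by apply/idP; lra.
have h : y.1%:R + 1 <= x.1%:R :> R by rewrite natr1 ler_nat.
by apply/negbTE; rewrite -leNgt; lra.
Qed.

Lemma place_inj x y : is_param x -> is_param y -> place x = place y -> x = y.
Proof.
move=> px py e; have : ~~ param_lt x y by rewrite -place_lt // e ltxx.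
have : ~~ param_lt y x by rewrite -place_lt // e ltxx.
case: x y {px py e} => [i s] [j t]; rewrite /param_lt /=.
by case: (ltngtP i j) => //= ->; rewrite -!leNgt => h1 h2; congr pair; apply/eqP; rewrite eq_le h1 h2.
Qed.

Variable ps : seq param.
Hypothesis ps_sorted : sorted (@param_lt R) ps.
Hypothesis ps_crossing : forall x, x \in ps <-> exists y, crossing x y.

Lemma passage_param x : x \in ps -> is_param x.
Proof. by move/ps_crossing => [y []]. Qed.

Lemma passage_inner x : x \in ps -> 0 < x.2.
Proof. by move/ps_crossing => [y /(crossing_spec)[]]. Qed.

Lemma param_lt_trans : transitive (@param_lt R).
Proof.
move=> [j t] [i s] [k u]; rewrite /param_lt /=.
case: (ltngtP i j) => //= [ij _|-> st].
  by case: (ltngtP j k) => //= [jk|<-]; rewrite ?ij // (ltn_trans ij jk).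
by case: (ltngtP j k) => //= _; apply: lt_trans.
Qed.

Lemma param_lt_irr : irreflexive (@param_lt R).
Proof. by move=> [i s]; rewrite /param_lt /= ltnn eqxx ltxx. Qed.

Lemma passages_uniq : uniq ps.
Proof. exact: (sorted_uniq param_lt_trans param_lt_irr). Qed.

Definition corners : seq param := [seq (i, 0 : R) | i <- iota 0 n].

(** The curve is cut at its vertices and at its passages through crossings, so
    that the inside of a segment between successive nodes is met once. *)
Definition nodes : seq param := sort (fun x y => place x <= place y) (corners ++ ps).
Notation M := (size nodes).

Lemma mem_corners (x : param) : (x \in corners) = (x.1 < n)%N && (x.2 == 0).
Proof.
apply/mapP/andP => [[i]|]; first by rewrite mem_iota add0n /= => iN ->.
by case: x => i s /= [iN /eqP->]; exists i; rewrite // mem_iota.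
Qed.

Lemma mem_nodes (x : param) : (x \in nodes) = (x \in corners) || (x \in ps).
Proof. by rewrite mem_sort mem_cat. Qed.

Lemma node_param (x : param) : x \in nodes -> is_param x.
Proof.
rewrite mem_nodes => /orP[|/passage_param//]; rewrite mem_corners.
by rewrite /Defs.is_param => /andP[-> /eqP->]; rewrite lexx ltr01.
Qed.

Lemma nodes_uniq : uniq nodes.
Proof.
rewrite sort_uniq cat_uniq passages_uniq map_inj_uniq ?iota_uniq ?andbT /=; last by move=> i j [].
apply/hasPn => x /passage_inner x0; rewrite mem_corners; apply/negP => /andP[_ /eqP x2].
by rewrite x2 ltxx in x0.
Qed.

(** The default value is the end of the curve: it serves as the node after the
    last one. *)
Definition node k : param := nth (n, 0) nodes k.
Definition node_place k : R := place (node k).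

Lemma mem_node k : (k < M)%N -> node k \in nodes.
Proof. exact: mem_nth. Qed.

Lemma node_default k : (M <= k)%N -> node k = (n, 0).
Proof. exact: nth_default. Qed.

Lemma place_param x : is_param x -> x.1%:R <= place x < x.1.+1%:R.
Proof. by move=> /andP[_ /andP[x0 x1]]; rewrite /place -natr1; apply/andP; split; lra. Qed.

Lemma place_end k : (k < M)%N -> node_place k < n%:R.
Proof.
move=> kM; have px := node_param (mem_node kM); have /andP[_ lt] := place_param px.
by apply: lt_le_trans lt _; rewrite ler_nat; case/andP: px.
Qed.

Lemma node_place_M : node_place M = n%:R.
Proof. by rewrite /node_place node_default // /place addr0. Qed.

Lemma node_place_lt i j : (i < j)%N -> (j <= M)%N -> node_place i < node_place j.
Proof.
move=> ij; rewrite leq_eqVlt => /orP[/eqP jE|jM].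
  by rewrite jE node_place_M place_end -?jE.
have iM := ltn_trans ij jM.
rewrite lt_neqAle; apply/andP; split.
  apply/eqP => /(place_inj (node_param (mem_node iM)) (node_param (mem_node jM))).
  by move/eqP; rewrite (nth_uniq _ iM jM nodes_uniq) ltn_eqF.
apply: (@sorted_ltn_nth _ (fun x y : param => place x <= place y)) => //.
- by move=> y x z; apply: le_trans.
- by apply: sort_sorted => x y; apply: le_total.
Qed.

Lemma node_place_le i j : (i <= j)%N -> (j <= M)%N -> node_place i <= node_place j.
Proof.
rewrite leq_eqVlt => /orP[/eqP->//|ij jM].
by apply/ltW/node_place_lt.
Qed.

Lemma node_place_ltE i j : (i <= M)%N -> (j <= M)%N -> (node_place i < node_place j) = (i < j)%N.
Proof.
move=> iM jM; case: ltnP => ij; first exact: node_place_lt.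
by apply/negbTE; rewrite -leNgt; apply: node_place_le.
Qed.

Lemma corner_node j : (j <= n)%N -> exists2 l, (l <= M)%N & node_place l = j%:R.
Proof.
rewrite leq_eqVlt => /orP[/eqP->|jn]; first by exists M => //; apply: node_place_M.
have jT : ((j, 0) : param) \in nodes by rewrite mem_nodes mem_corners jn eqxx.
exists (index ((j, 0) : param) nodes); first by apply/ltnW; rewrite index_mem.
by rewrite /node_place /node nth_index // /place addr0.
Qed.

Lemma nodes_gt0 : (0 < M)%N.
Proof.
have jT : ((0%N, 0) : param) \in nodes by rewrite mem_nodes mem_corners nedges_gt0 // eqxx.
by case: nodes jT.
Qed.

Lemma node0 : node 0 = (0%N, 0).
Proof.
have p0 := node_param (mem_node nodes_gt0).
have q0 : is_param (0%N, 0) by rewrite /Defs.is_param nedges_gt0 // lexx ltr01.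
apply: (place_inj p0 q0); have [l lM lE] := corner_node (leq0n n).
have := node_place_le (leq0n l) lM; rewrite lE /node_place => le0.
have /andP[h _] := place_param p0.
have : 0 <= place (node 0) by apply: le_trans h; rewrite ler0n.
by move=> ge0; apply/eqP; rewrite eq_le {2 3}/place /= addr0 le0 ge0.
Qed.

(** The index is reduced because the end of the curve is the first vertex on the
    circle. *)
Definition pt k : R * R := if (k < M)%N then point (node k) else vx (n %% size (vertices K)).

Lemma pt_inner k : (k < M)%N -> pt k = point (node k). Proof. by rewrite /pt => ->. Qed.

Lemma node_bounds k : (k < M)%N ->
  (node k).1%:R <= node_place k /\ node_place k.+1 <= (node k).1%:R + 1.
Proof.
move=> kM; have px := node_param (mem_node kM); have /andP[h1 h2] := place_param px.
split=> //; have [|l lM lE] := @corner_node (node k).1.+1; first by case/andP: px.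
rewrite natr1 -lE; apply: node_place_le => //.
by rewrite -(node_place_ltE (ltnW kM) lM) lE.
Qed.

Lemma pt_next k : (k < M)%N -> pt k.+1 = point ((node k).1, node_place k.+1 - (node k).1%:R).
Proof.
move=> kM; have [h1 h2] := node_bounds kM.
have px := node_param (mem_node kM); have xn : ((node k).1 < n)%N by case/andP: px.
have lt := node_place_lt (ltnSn k) kM.
move: h2; rewrite le_eqVlt => /orP[/eqP e|h2].
  rewrite e (addrC _ 1) addrK point_end /pt; move: kM; rewrite leq_eqVlt => /orP[/eqP kM|kM].
    rewrite kM ltnn; congr (vx (_ %% _)); apply/eqP; rewrite -(eqr_nat R) -natr1 -e kM.
    by rewrite node_place_M.
  have in_n : ((node k).1.+1 < n)%N by rewrite -(ltr_nat R) -natr1 -e place_end.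
  rewrite kM modn_small; last by apply: leq_trans in_n nedges_size.
  rewrite -point_start; congr point.
  apply: (place_inj (node_param (mem_node kM))).
    by rewrite /Defs.is_param /= in_n lexx ltr01.
  by rewrite /place addr0 -natr1 -e.
have kM' : (k.+1 < M)%N.
  rewrite ltn_neqAle kM andbT; apply/eqP => kE.
  move: h2; rewrite kE node_place_M natr1 ltr_nat ltnS leqNgt xn //.
rewrite pt_inner //; have py := node_param (mem_node kM').
have /andP[g1 g2] := place_param py.
have yE : (node k.+1).1 = (node k).1.
  apply/eqP; rewrite eqn_leq -ltnS -[X in _ && X]ltnS -!(ltr_nat R) -!natr1.
  by rewrite /node_place in lt h1 h2; rewrite -natr1 in g2; apply/andP; split; lra.
congr point; rewrite [LHS]surjective_pairing yE; congr pair.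
by rewrite /node_place /place yE addrC addKr.
Qed.

Variable d : R.
Hypothesis steep : forall i, (i < n)%N -> (shear d (edge i)).1 != 0.
Hypothesis bounds : b = Line -> forall i, (i <= n)%N ->
  ((0 < i)%N -> (shear d (vx 0)).1 < (shear d (vx i)).1) /\
  ((i < n)%N -> (shear d (vx i)).1 < (shear d (vx n)).1).

Definition walk k := shear d (pt k).

Lemma shear_inj : injective (shear d).
Proof. by move=> [x y] [x' y'] [] /[swap] <- /addIr <-. Qed.

Lemma node_edge k : (k < M)%N -> ((node k).1 < n)%N.
Proof. by move=> kM; have /andP[] := node_param (mem_node kM). Qed.

Lemma walk_along k u : (k < M)%N -> along (walk k) (walk k.+1) u =
  shear d (point ((node k).1, ((node_place k - (node k).1%:R)
             + u * (node_place k.+1 - node_place k)))).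
Proof.
move=> kM; rewrite /walk (pt_next kM) (pt_inner kM).
have -> : point (node k) = point ((node k).1, node_place k - (node k).1%:R).
  by congr point; rewrite [LHS]surjective_pairing /node_place /place addrC addKr.
by rewrite /along /shear /Defs.point /=; congr pair; ring.
Qed.

Lemma walk_vector k : (k < M)%N ->
  let s := node_place k.+1 - node_place k in
  (walk k.+1).1 - (walk k).1 = s * (shear d (edge (node k).1)).1 /\
  (walk k.+1).2 - (walk k).2 = s * (shear d (edge (node k).1)).2.
Proof.
move=> kM s; have := walk_along 1 kM; have := walk_along 0 kM.
rewrite /along !mul0r !mul1r !addr0 !subrKC -!surjective_pairing => -> ->.
by rewrite /shear /Defs.point /= /s; split; ring.
Qed.

Lemma step_gt0 k : (k < M)%N -> 0 < node_place k.+1 - node_place k.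
Proof. by move=> kM; rewrite subr_gt0; apply: (node_place_lt). Qed.

Lemma walk_steep k : (k < M)%N -> (walk k).1 != (walk k.+1).1.
Proof.
move=> kM; rewrite eq_sym -subr_eq0 (walk_vector kM).1 mulf_neq0 ?steep ?node_edge //.
by rewrite gt_eqF ?step_gt0.
Qed.

(** A meeting of two segments inside the first one would be a crossing, hence a
    node, but nodes are ends of segments. *)
Lemma walk_apart k l : (k < M)%N -> (l < M)%N -> k <> l ->
  apart (walk k) (walk k.+1) (walk l) (walk l.+1).
Proof.
move=> kM lM kl u t u01 t01; rewrite !walk_along // => /shear_inj.
have [k1 k2] := node_bounds kM.
have [l1 l2] := node_bounds lM.
have [ks ls] := (step_gt0 kM, step_gt0 lM).
set x := (_, _); set y := (_, _) => /esym xy.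
have place_x : place x = node_place k + u * (node_place k.+1 - node_place k).
  by rewrite /place /=; ring.
have place_y : place y = node_place l + t * (node_place l.+1 - node_place l).
  by rewrite /place /=; ring.
have [xk xk'] : node_place k < place x /\ place x < node_place k.+1.
  by rewrite place_x; split; nra.
have [yl yl'] : node_place l <= place y /\ place y <= node_place l.+1.
  by rewrite place_y; split; nra.
have x2 : 0 < x.2 < 1 by rewrite /= ; apply/andP; split; nra.
have px : is_param x by rewrite /Defs.is_param node_edge //=; apply/andP; split; [apply/ltW|]; case/andP: x2.
have xn : x \notin nodes.
  apply/negP => xT; have iM : (index x nodes < M)%N by rewrite index_mem.
  have iE : node_place (index x nodes) = place x by rewrite /node_place /node nth_index.
  have mono := node_place_ltE.
  have h1 : node_place k < node_place (index x nodes) by rewrite iE.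
  have h2 : node_place (index x nodes) < node_place k.+1 by rewrite iE.
  rewrite (mono k _ (ltnW kM) (ltnW iM)) in h1.
  by rewrite (mono _ k.+1 (ltnW iM) kM) ltnS leqNgt h1 in h2.
move: xy; apply: (not_crossed) => //.
- by case/andP: x2.
- move=> z cr; move/negP: xn; apply; rewrite mem_nodes.
  by apply/orP; right; apply/ps_crossing; exists z.
- exact: node_edge.
- by rewrite /y /=; apply/andP; split; nra.
move=> yx; have xE : place y = place x by congr place.
rewrite xE in yl yl'; clear place_x place_y xE.
case: (ltngtP k l) kl => // lt _.
  by have := node_place_le lt (ltnW lM); lra.
by have := node_place_le lt (ltnW kM); lra.
Qed.

Let node_param' k : (k < M)%N -> is_param (node k).
Proof. by move=> kM; apply: (node_param); apply: mem_node. Qed.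

Let node_inj k l : (k < M)%N -> (l < M)%N -> node k = node l -> k = l.
Proof.
by move=> kM lM /eqP; rewrite (nth_uniq _ kM lM (nodes_uniq)) => /eqP.
Qed.

Lemma pt_M_circle : b = Circle -> pt M = pt 0.
Proof.
move=> bC; rewrite /pt ltnn (nodes_gt0) (node0) point_start.
by rewrite /nedges bC modnn.
Qed.

Lemma pt_M_line : b = Line -> pt M = vx n.
Proof. by move=> bL; rewrite /pt ltnn (line_mod bL (leqnn _)). Qed.

Lemma walk_eq k l : (0 < k < M)%N -> (l <= M)%N -> walk l = walk k ->
  l = k \/ (l < M)%N /\ crossing (node k) (node l).
Proof.
move=> /andP[k0 kM] lM /shear_inj e; have [->|/eqP lk] := eqVneq l k; first by left.
right; have cross l' : (l' < M)%N -> l' <> k -> pt l' = pt k -> crossing (node k) (node l').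
  move=> l'M l'k; rewrite !pt_inner // => e'; split=> //; try exact: node_param'.
  by move/node_inj => /(_ kM l'M) kl; apply: l'k.
move: lM; rewrite leq_eqVlt => /orP[/eqP lM|lM]; last by split=> //; apply: cross.
move: e; rewrite lM; case bE : b.
  rewrite -bE pt_M_line // pt_inner // => e.
  by have := point_before_end bE (node_param' kM); rewrite -e ltxx.
rewrite -bE pt_M_circle // => /(cross _ (nodes_gt0)) cr.
have /cr : 0%N <> k by move=> e; rewrite -e in k0.
rewrite (node0) => {}cr.
by have [_ /=] := crossing_spec cr; rewrite ltxx.
Qed.

Lemma walk_once k : (0 < k < M)%N -> node k \notin ps ->
  forall l, (l <= M)%N -> (walk l == walk k) = (l == k).
Proof.
move=> kM kn l lM; apply/eqP/eqP => [|->//] /(walk_eq kM lM)[->//|[_ cr]].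
by move/negP: kn; case; apply/ps_crossing; exists (node l).
Qed.

(** A third visit at the crossing would make a triple point. *)
Lemma walk_twice k k' : (0 < k < M)%N -> (k' < M)%N -> crossing (node k) (node k') ->
  forall l, (l <= M)%N -> (walk l == walk k) = (l == k) || (l == k').
Proof.
move=> kM k'M cr l lM; apply/eqP/orP => [/(walk_eq kM lM)[->|[lM' cr']]|[/eqP->//|/eqP->]].
- by left.
- right; apply/eqP; apply: node_inj => //; apply: contrapT => neq.
  case: dK => _ _ tri _; apply: (tri _ _ _ (crossing_sym cr) cr').
  case: cr cr' => [_ p2 _ e] [_ p3 _ e']; split=> //; first exact: nesym.
  by rewrite -e -e'.
case: cr => _ _ _ e; rewrite /walk !pt_inner //; first by rewrite e.
by case/andP: kM.
Qed.

Lemma node_passage_gt0 k : (k < M)%N -> node k \in ps -> (0 < k)%N.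
Proof.
case: k => // _; rewrite (node0) => /(passage_inner) /=.
by rewrite ltxx.
Qed.

(** Passages are in the interior of edges. *)
Lemma same_edge j : (j.+1 < M)%N -> node j.+1 \in ps -> (node j).1 = (node j.+1).1.
Proof.
move=> jM jp; have jM' := ltnW jM.
have f0 := passage_inner jp.
have [h1 h2] := node_bounds jM'.
have lt := node_place_lt (ltnSn j) jM'.
have /andP[g1 g2] := place_param (node_param' jM).
have g3 : node_place j.+1 = (node j.+1).1%:R + (node j.+1).2 by [].
rewrite /node_place in h1 h2 lt g3.
apply/eqP; rewrite eqn_leq -ltnS -[X in _ && X]ltnS -!(ltr_nat R) -!natr1.
by rewrite -natr1 in g2; apply/andP; split; lra.
Qed.

Lemma walk_opposite j : (j.+1 < M)%N -> node j.+1 \in ps ->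
  opposite (walk j.+1) (walk j.+2) (walk j).
Proof.
move=> jM jp; have jM' := ltnW jM.
have [v1 v2] := walk_vector jM.
have [w1 w2] := walk_vector jM'.
have [s1 s2] := (step_gt0 jM, step_gt0 jM').
rewrite (same_edge jM jp) in w1 w2.
move: (node_place j.+2 - _) (node_place j.+1 - _) s1 s2 v1 v2 w1 w2 => s s' s0 s0' v1 v2 w1 w2.
have s0n : s != 0 by rewrite gt_eqF.
exists (s' / s); first by rewrite divr_gt0.
rewrite v1 v2 !mulrA !divfK //; split; lra.
Qed.

Lemma walk_turn j j' : (j < M)%N -> (j' < M)%N -> walk j = walk j' ->
  (0 < turn (walk j) (walk j.+1) (walk j'.+1)) = (0 < det (edge (node j).1) (edge (node j').1))
  /\ (turn (walk j) (walk j.+1) (walk j'.+1) != 0) = (det (edge (node j).1) (edge (node j').1) != 0).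
Proof.
move=> jM jM' e.
have [v1 v2] := walk_vector jM.
have [w1 w2] := walk_vector jM'.
have [s1 s2] := (step_gt0 jM, step_gt0 jM').
have -> : turn (walk j) (walk j.+1) (walk j'.+1) =
    (node_place j.+1 - node_place j) * (node_place j'.+1 - node_place j')
     * det (edge (node j).1) (edge (node j').1).
  by rewrite /turn v1 v2 e w1 w2 /det /shear /=; ring.
rewrite !mulf_eq0 !negb_or (gt_eqF s1) (gt_eqF s2); split=> //.
by rewrite pmulr_rgt0 // mulr_gt0.
Qed.

Lemma line_walk l : b = Line -> (0 < l < M)%N ->
  (walk 0).1 < (walk l).1 /\ (walk l).1 < (walk M).1.
Proof.
move=> bL /andP[l0 lM]; have M0 := nodes_gt0.
rewrite /walk pt_M_line // !pt_inner // (node0) point_start.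
have /andP[iN /andP[s0 s1]] := node_param' lM.
have i1 : edge (node l).1 = vx (node l).1.+1 - vx (node l).1.
  by rewrite /Defs.edge (line_mod bL iN).
have E : (shear d (point (node l))).1 = (1 - (node l).2) * (shear d (vx (node l).1)).1
      + (node l).2 * (shear d (vx (node l).1.+1)).1.
  by rewrite /shear /Defs.point i1 /=; ring.
have [_ /(_ iN) h1] := bounds bL (ltnW iN).
have [/(_ isT) h2 _] := bounds bL iN.
have h3 : (shear d (vx (node l).1.+1)).1 <= (shear d (vx n)).1.
  have [->//|xn'] := eqVneq (node l).1.+1 n.
  by apply/ltW; apply: (bounds bL iN).2; rewrite ltn_neqAle xn' iN.
have h4 : (shear d (vx 0)).1 <= (shear d (vx (node l).1)).1.
  have [->//|xn'] := eqVneq (node l).1 0%N.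
  by apply/ltW; apply: (bounds bL (ltnW iN)).1; rewrite lt0n.
have h5 : (shear d (vx 0)).1 < (shear d (vx (node l).1)).1 \/ 0 < (node l).2.
  have [i0|xn'] := eqVneq (node l).1 0%N; last first.
    by left; apply: (bounds bL (ltnW iN)).1; rewrite lt0n.
  right; rewrite lt0r s0 andbT; apply/eqP => s00.
  have /node_inj : node l = node 0.
    by rewrite (node0) [LHS]surjective_pairing i0 s00.
  by move=> /(_ lM M0) l00; rewrite l00 in l0.
rewrite E; move: s0 s1 h1 h2 h3 h4 h5.
move: (node l).2 (shear d (vx (node l).1)).1 (shear d (vx (node l).1.+1)).1 (shear d (vx 0)).1
  (shear d (vx n)).1 => s x y x0 xn; clear => s0 s1 h1 h2 h3 h4 h5.
have hy : x0 < y by [].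
by split; case: h5 => h5; nra.
Qed.

Lemma passages_of_nodes : filter (mem ps) nodes = ps.
Proof.
apply: (irr_sorted_eq param_lt_trans param_lt_irr) => //.
  apply: sorted_filter; first exact: param_lt_trans.
  apply/(sortedP (n, 0)) => i iM.
  have iM' := ltnW iM.
  rewrite -place_lt ?(node_param) ?mem_nth //.
  exact: (node_place_lt (ltnSn i) iM').
move=> x; rewrite mem_filter /= mem_nodes.
by case: (x \in ps); rewrite ?orbT.
Qed.

Lemma count_take_node k : (k < M)%N ->
  count (mem ps) (take k.+1 nodes) = (count (mem ps) (take k nodes) + (node k \in ps))%N.
Proof. by move=> kM; rewrite (take_nth (n, 0)) // -cats1 count_cat /= addn0. Qed.

Lemma index_passage k : (k < M)%N -> node k \in ps ->
  index (node k) ps = count (mem ps) (take k nodes).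
Proof.
move=> kM kp.
have psE : filter (mem ps) (take k nodes) ++ node k :: filter (mem ps) (drop k.+1 nodes) = ps.
  rewrite -[RHS]passages_of_nodes -[in RHS](cat_take_drop k nodes) (drop_nth (n, 0) kM).
  by rewrite filter_cat /= -/(node k) kp.
have u : uniq (filter (mem ps) (take k nodes) ++ node k :: filter (mem ps) (drop k.+1 nodes)).
  by rewrite psE; apply: (passages_uniq).
by have := index_cat_cons u; rewrite psE size_filter.
Qed.

Definition passage_node g := index (nth (n, 0) ps g) nodes.

Lemma passage_nodeP g : (g < size ps)%N ->
  [/\ (passage_node g < M)%N, node (passage_node g) = nth (n, 0) ps g & (0 < passage_node g)%N].
Proof.
move=> gp; have gin : nth (n, 0) ps g \in ps by apply: mem_nth.
have iM : (passage_node g < M)%N by rewrite index_mem mem_nodes gin orbT.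
have nE : node (passage_node g) = nth (n, 0) ps g.
  by rewrite /node nth_index // mem_nodes gin orbT.
split=> //; apply: (node_passage_gt0 iM).
by rewrite nE.
Qed.

(** Gap [g] of the word is the part of the curve between two successive
    passages; its first segment starts at the passage that precedes the gap, or
    at the start of the curve for [g = 0]. *)
Definition at_gap T (f : nat -> T) g := if g is g'.+1 then f (passage_node g') else f 0%N.

(** A function of the segments that does not change at plain vertices is constant
    along each gap. *)
Lemma at_gap_count T (f : nat -> T) :
  (forall j, (j.+1 < M)%N -> node j.+1 \notin ps -> f j.+1 = f j) ->
  forall k, (k < M)%N -> at_gap f (count (mem ps) (take k.+1 nodes)) = f k.
Proof.
move=> fc; elim=> [|k IH] kM; rewrite count_take_node //.
  rewrite take0 /=; have [/(node_passage_gt0 kM)|] := boolP (node 0 \in ps).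
    by rewrite ltnn.
  by [].
have [kp|kp] := boolP (node k.+1 \in ps); last by rewrite addn0 IH ?fc // ltnW.
rewrite addn1 /= -index_passage // /passage_node nth_index //.
by rewrite index_uniq // (nodes_uniq).
Qed.

Lemma at_gap_passage T (f : nat -> T) g (e : bool) :
  (forall j, (j.+1 < M)%N -> node j.+1 \notin ps -> f j.+1 = f j) -> (g < size ps)%N ->
  at_gap f (g + e)%N = if e then f (passage_node g) else f (passage_node g).-1.
Proof.
move=> fc gp; have [kM kE k0] := passage_nodeP gp.
case: e; rewrite ?addn1 // addn0.
have gE : g = count (mem ps) (take (passage_node g) nodes).
  rewrite -index_passage // kE ?mem_nth // index_uniq //.
  exact: (passages_uniq).
rewrite {1}gE -{1}(prednK k0) at_gap_count // prednK //; exact: ltnW.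
Qed.

Lemma at_gap_last T (f : nat -> T) :
  (forall j, (j.+1 < M)%N -> node j.+1 \notin ps -> f j.+1 = f j) ->
  at_gap f (size ps) = f M.-1.
Proof.
move=> fc; have M0 := nodes_gt0.
have -> : size ps = count (mem ps) (take M.-1.+1 nodes).
  by rewrite prednK // take_size -size_filter passages_of_nodes.
by rewrite at_gap_count // prednK.
Qed.

Section Loop.
Variables a c : nat.
Hypotheses (a_ps : node a \in ps) (ac : (a < c)%N) (cM : (c < M)%N).
Hypothesis ac_cross : crossing (node a) (node c).

Let c_ps : node c \in ps.
Proof. by apply/ps_crossing; exists (node a); apply: crossing_sym. Qed.

Let aM : (a < M)%N := ltn_trans ac cM.
Let a0 : (0 < a)%N := node_passage_gt0 aM a_ps.

Lemma walk_loop : walk a = walk c.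
Proof.
have a0M : (0 < a < M)%N by rewrite a0 aM.
by apply/eqP; rewrite eq_sym (walk_twice a0M cM ac_cross (ltnW cM)) eqxx orbT.
Qed.

Definition colour k := left_colour walk a c k.

Lemma colour_step j : (j.+1 < M)%N -> node j.+1 \notin ps ->
  colour j.+1 = colour j /\ on_loop a c j.+1 = on_loop a c j.
Proof.
move=> jM jn.
have same : on_loop a c j = on_loop a c j.+1.
  have na : (j.+1 == a) = false by apply/negP => /eqP e; move: jn; rewrite e a_ps.
  have nc : (j.+1 == c) = false by apply/negP => /eqP e; move: jn; rewrite e c_ps.
  by have := on_loop_step ac j; rewrite na nc; case: on_loop; case: on_loop.
split=> //; apply: (left_colour_vertex walk_steep walk_apart ac (ltnW cM) walk_loop jM) => //.
by apply: walk_once.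
Qed.

(** The walk does not return to its first and last points, hence no branch
    matters there.  These points coincide for the circle; for the line they are
    to the left and to the right of all others, and nothing is above them. *)
Lemma colour_ends : (b = Circle /\ colour 0 = colour M.-1) \/
  (colour 0 = false /\ colour M.-1 = false).
Proof.
have M0 := nodes_gt0.
have out v z : (forall l, (0 < l < M)%N -> walk l <> v) -> branches walk a c v z = false.
  move=> nv; rewrite /branches big_nat_cond big1 // => l /andP[/andP[al lc] _].
  have -> : (walk l == v) = false by apply/eqP/nv; lia.
  by have -> : (walk l.+1 == v) = false by apply/eqP/nv; lia.
have far l : (0 < l < M)%N -> walk l <> walk 0 /\ walk l <> walk M.
  move=> lM; split=> /esym e.
    have [l0|[_ cr]] := walk_eq lM (leq0n M) e; first by rewrite -l0 in lM.
    rewrite (node0) in cr.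
    by have [_ /=] := crossing_spec cr; rewrite ltxx.
  by have [l0|[]] := walk_eq lM (leqnn M) e; [move: lM; rewrite -l0 ltnn andbF|rewrite ltnn].
have on0 : on_loop a c 0 = false by rewrite /on_loop; lia.
have onM : on_loop a c M.-1 = false by rewrite /on_loop; lia.
have c0 : colour 0 = depth walk a c (walk 0).
  rewrite /colour /left_colour /top_colour on0 andbF addbF out ?addbF // => l /far[] //.
have cM' : colour M.-1 = depth walk a c (walk M).
  rewrite /colour (left_colour_pred walk_steep walk_apart ac (ltnW cM) walk_loop) ?prednK // onM andbF addbF.
  by rewrite out ?addbF // => l /far[].
rewrite c0 cM'.
have [bE|bE] : b = Circle \/ b = Line by case: (b); [right|left].
  by left; split=> //; rewrite /walk pt_M_circle.
right.
have low z l : (forall l, (0 < l < M)%N -> (walk l).1 <= z.1) -> (a <= l < c)%N ->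
    shades (walk l) (walk l.+1) z = false.
  by move=> H lac; rewrite /shades !H //; lia.
have high z l : (forall l, (0 < l < M)%N -> z.1 < (walk l).1) -> (a <= l < c)%N ->
    shades (walk l) (walk l.+1) z = false.
  by move=> H lac; rewrite /shades !leNgt !H //; lia.
split; rewrite /depth big_nat_cond big1 // => l /andP[lac _].
  by apply: high => // l' /(line_walk bE)[].
by apply: low => // l' /(line_walk bE)[_ /ltW].
Qed.

End Loop.
End Knot.

(** * Parities of planar diagrams vanish *)
Section KnotParity.
Variables (R : realType) (b : base) (K : knot_data R) (P : gauss unit -> arrow unit -> bool).
Hypotheses (dK : knot_diagram b K) (parP : parity b P).
Notation n := (nedges b K).

Lemma ex_shear : exists d : R,
  (forall i, (i < n)%N -> (shear d (edge K i)).1 != 0) /\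
  (b = Line -> forall i, (i <= n)%N ->
    ((0 < i)%N -> (shear d (vertex K 0)).1 < (shear d (vertex K i)).1) /\
    ((i < n)%N -> (shear d (vertex K i)).1 < (shear d (vertex K n)).1)).
Proof.
pose us := [seq edge K i | i <- iota 0 n] ++ [seq vertex K i - vertex K 0 | i <- iota 0 n.+1]
  ++ [seq vertex K n - vertex K i | i <- iota 0 n.+1].
have [d d0 H] := generic_shear us; exists d; split.
  move=> i iN; apply: (H (edge K i) _).2; last exact: (edge_neq0 dK iN).
  by rewrite !mem_cat; apply/orP; left; apply/mapP; exists i; rewrite // mem_iota.
move=> bL i iN; have [h1 h2] := line_bounds dK bL iN.
have lin (x y : R * R) : x - y \in us -> y.1 < x.1 -> (shear d y).1 < (shear d x).1.
  move=> /H[+ _] yx; rewrite /shear /= subr_gt0 => /(_ yx).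
  by rewrite mulrBr; lra.
split=> [/h1|/h2]; apply: lin; rewrite !mem_cat.
  by apply/orP; right; apply/orP; left; apply/mapP; exists i; rewrite // mem_iota ltnS.
by apply/orP; right; apply/orP; right; apply/mapP; exists i; rewrite // mem_iota ltnS.
Qed.

(** The loop of the curve between the two passages of [x0] colours the sides of
    the curve, and the colouring satisfies the conditions of
    [even_of_colouring]: at a crossing other than [x0] both strands stay on the
    loop or off it, while at [x0] each strand has one half-edge on the loop. *)
Theorem even_of_knot (D : gauss unit) x0 :
  gauss_diagram_of b K D -> x0 \in arrows D -> P D x0 = false.
Proof.
move=> [ps [c [[ps_sorted ps_crossing] wE c_same c_over c_sgn]]] x0D.
have [d [steep bounds]] := ex_shear.
rewrite -parity_wordE; set w := gword D.
have gw : gauss_word w by rewrite /w; case: (D).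
have sw : size w = size ps by rewrite /w wE size_map.
pose wi x e := index ((x, e) : endpoint unit) w.
pose nd := node b K ps; pose pn := passage_node b K ps.
have wiP x e : (x, e) \in w -> (wi x e < size ps)%N /\ c (nd (pn (wi x e))) = (x, e).
  move=> xw; have lt : (wi x e < size ps)%N by rewrite -sw index_mem.
  have [_ nE _] := passage_nodeP dK ps_sorted ps_crossing lt.
  split=> //; rewrite /nd /pn nE -(nth_map _ (x, e)) // -wE.
  exact: nth_index.
have flip x e : (x, e) \in w -> (x, ~~ e) \in w by case/andP: gw => _ /allP h /h.
have nd_ps x e : (x, e) \in w -> [/\ (pn (wi x e) < size (nodes b K ps))%N,
    nd (pn (wi x e)) \in ps & (0 < pn (wi x e))%N].
  move=> xw; have [lt _] := wiP x e xw.
  have [pM nE p0] := passage_nodeP dK ps_sorted ps_crossing lt.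
  by split=> //; rewrite /nd /pn nE mem_nth.
have cross x : (x, false) \in w -> crossing b K (nd (pn (wi x false))) (nd (pn (wi x true))).
  move=> xw; have xw' := flip x false xw.
  have [_ u_ps _] := nd_ps _ _ xw; have [_ v_ps _] := nd_ps _ _ xw'.
  have [_ cu] := wiP _ _ xw; have [_ cv] := wiP _ _ xw'.
  split; try exact: (passage_param ps_crossing).
    by move=> uv; move: cv; rewrite -uv cu.
  by apply/(c_same _ _ u_ps v_ps); rewrite cu cv.
(* Arrows start at the upper passage, where the sign is given by the
   determinant of the two edges. *)
have sgnE x : (x, false) \in w ->
    sgn x = (0 < det (edge K (nd (pn (wi x false))).1) (edge K (nd (pn (wi x true))).1)).
  move=> xw; have [_ u_ps _] := nd_ps _ _ xw; have [_ cu] := wiP _ _ xw.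
  rewrite -(c_sgn _ _ (cross x xw)) ?cu //.
  by have := c_over _ u_ps; rewrite cu => /esym/negbFE.
have eq_pn x e y f : (x, e) \in w -> (y, f) \in w ->
    (pn (wi x e) == pn (wi y f)) = (x == y) && (e == f).
  move=> xw yw; apply/eqP/andP => [E|[/eqP -> /eqP ->]//].
  have [_ cx] := wiP _ _ xw; have [_ cy] := wiP _ _ yw.
  by move: cx; rewrite E cy => -[-> ->].
have x0w : (x0, false) \in w by exact: arrows_mem.
have x0w' := flip x0 false x0w.
have [a [e [aps ae eM ae_cross aeE]]] : exists a e, [/\ nd a \in ps, (a < e)%N,
    (e < size (nodes b K ps))%N, crossing b K (nd a) (nd e) &
    forall k, (k == a) (+) (k == e) = (k == pn (wi x0 false)) (+) (k == pn (wi x0 true))].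
  have [tM t_ps _] := nd_ps _ _ x0w; have [hM h_ps _] := nd_ps _ _ x0w'.
  have := eq_pn _ _ _ _ x0w x0w'; rewrite eqxx /=; case: ltngtP => // lt _.
    by exists (pn (wi x0 false)), (pn (wi x0 true)); split=> //; apply: cross.
  exists (pn (wi x0 true)), (pn (wi x0 false)); split=> //.
    by apply: crossing_sym; apply: cross.
  by move=> k; rewrite addbC.
have a0 : (0 < a)%N by apply: (node_passage_gt0 dK ps_sorted ps_crossing (ltn_trans ae eM) aps).
pose lam := colour b K ps d a e.
(* The colour on the right of a segment differs from the one on the left if the
   segment is on the loop. *)
pose chi g t := at_gap b K ps lam g (+) (t && at_gap b K ps (on_loop a e) g).
have step j : (j.+1 < size (nodes b K ps))%N -> nd j.+1 \notin ps ->
    lam j.+1 = lam j /\ on_loop a e j.+1 = on_loop a e j.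
  exact: (colour_step dK ps_sorted ps_crossing steep aps ae eM ae_cross).
have chiE g (f t : bool) : (g < size ps)%N -> chi (g + f)%N t =
    (if f then lam (pn g) (+) (t && on_loop a e (pn g))
     else lam (pn g).-1 (+) (t && on_loop a e (pn g).-1)).
  move=> gp; rewrite /chi !(at_gap_passage dK ps_sorted ps_crossing) //.
  - by case: f.
  - by move=> j jM jn; have [] := step j jM jn.
  by move=> j jM jn; have [] := step j jM jn.
have on_pn x f : (x, f) \in w ->
    on_loop a e (pn (wi x f)).-1 (+) on_loop a e (pn (wi x f)) = (x == x0).
  move=> xw; have [_ _ p0] := nd_ps _ _ xw.
  have := on_loop_step ae (pn (wi x f)).-1; rewrite prednK // => ->.
  rewrite aeE !eq_pn //; case: (x == x0) => //=; by case: (f).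
apply: (even_of_colouring parP (chi := chi) gw x0w).
- move=> x xw ta tb; have xw' := flip x false xw.
  have [gt _] := wiP _ _ xw; have [gh _] := wiP _ _ xw'.
  rewrite -/(wi x false) -/(wi x true) !chiE //.
  have [tM t_ps t0] := nd_ps _ _ xw; have [hM h_ps h0] := nd_ps _ _ xw'.
  have on_t := on_pn x _ xw; have on_h := on_pn x _ xw'.
  have cr := cross x xw; have tE := sgnE x xw; have neq := eq_pn _ _ _ _ xw xw'.
  move: (pn (wi x false)) (pn (wi x true)) tM hM t0 h0 t_ps h_ps cr on_t on_h tE neq.
  move=> [//|j] [//|j'] /= jM jM' _ _ jps jps' cr on_t on_h tE neq.
  have jj' : j != j' by move: neq; rewrite eqSS eqxx andbF => ->.
  have occ := walk_twice dK ps_sorted ps_crossing d (k := j.+1) jM jM' cr.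
  have vE : walk b K ps d j'.+1 = walk b K ps d j.+1.
    by apply/eqP; rewrite occ ?eqxx ?orbT // ltnW.
  have [turnE turn0] := walk_turn dK ps_sorted ps_crossing jM jM' (esym vE).
  have [_ _ det0] := crossing_spec dK cr.
  have op := walk_opposite dK ps_sorted ps_crossing d jM jps.
  have op' := walk_opposite dK ps_sorted ps_crossing d jM' jps'.
  rewrite vE in op'; rewrite tE -turnE.
  apply: (left_colour_crossing (walk_steep dK ps_sorted ps_crossing steep)
    (walk_apart dK ps_sorted ps_crossing (d := d)) ae (ltnW eM)
    (walk_loop dK ps_sorted ps_crossing d aps ae eM ae_cross) ta tb jM jM' jj' vE occ op op').
    by rewrite turn0.
  by rewrite on_t on_h addbb.
- move=> x xw; have [gt _] := wiP _ _ xw.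
  have C0 t := chiE _ false t gt; have C1 t := chiE _ true t gt.
  rewrite /= addn0 in C0; rewrite /= addn1 in C1.
  rewrite /= -/(wi x false) !C0 !C1 -(on_pn x false xw) /= !addbF.
  by rewrite !addKb.
have on0 : on_loop a e 0 = false by rewrite /on_loop; lia.
have onM : on_loop a e (size (nodes b K ps)).-1 = false by rewrite /on_loop; lia.
have chi0 t : chi 0%N t = lam 0%N by rewrite /chi /= on0 andbF addbF.
have chiM t : chi (size w) t = lam (size (nodes b K ps)).-1.
  rewrite /chi sw !(at_gap_last dK ps_sorted ps_crossing) ?onM ?andbF ?addbF //.
  - by move=> j jM jn; have [] := step j jM jn.
  by move=> j jM jn; have [] := step j jM jn.
case: (colour_ends dK ps_sorted ps_crossing steep bounds aps ae eM ae_cross) => [[bC E]|[E E']].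
  by left; split=> // t; rewrite chi0 chiM.
by right; split=> t; rewrite ?chi0 ?chiM /lam ?E ?E'.
Qed.

End KnotParity.

(** * Quotients by generated subgroups *)
Section Zspan.
Variables (V : zmodType) (S : V -> Prop).

Lemma zspan_gen r : S r -> zspan S r.
Proof. by move=> Sr; rewrite -[r]add0r; apply: zspan_add => //; apply: zspan0. Qed.

Lemma zspanB x y : zspan S x -> zspan S y -> zspan S (x - y).
Proof.
by have [_ B] := zspanb_closed S; move=> /asboolP xS /asboolP yS; apply/asboolP/B.
Qed.

Lemma zspanD x y : zspan S x -> zspan S y -> zspan S (x + y).
Proof.
by move=> xS yS; rewrite -[y]opprK; apply: zspanB => //; rewrite -sub0r; apply: zspanB => //; apply: zspan0.
Qed.

Lemma zprojP x y : zproj S x = zproj S y <-> zspan S (x - y).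
Proof.
have E : (x - y \in zspanb S) = (zproj S x == zproj S y).
  by rewrite (Quotient.idealrBE (zspanb S)).
by rewrite -[zspan S _]/(zspan S _); split => [/eqP|/asboolP h]; [rewrite -E => /asboolP|apply/eqP; rewrite -E].
Qed.

Lemma zprojB x y : zproj S (x - y) = zproj S x - zproj S y.
Proof. exact: (pi_is_additive (Quotient.quot (zspanb S))). Qed.

Lemma zproj_repr (z : zquot S) : zproj S (repr z) = z.
Proof. exact: reprK. Qed.

End Zspan.

Section ZquotMap.
Variables (V W : zmodType) (S : V -> Prop) (T : W -> Prop) (f : {additive V -> W}).
Hypothesis f_rel : forall r, S r -> zspan T (f r).

Lemma zspan_map x : zspan S x -> zspan T (f x).
Proof.
elim=> [|y z _ IH /f_rel zT|y z _ IH /f_rel zT]; first by rewrite raddf0; apply: zspan0.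
  by rewrite raddfD; apply: zspanD.
by rewrite raddfB; apply: zspanB.
Qed.

Definition zquot_map (z : zquot S) : zquot T := zproj T (f (repr z)).

Lemma zquot_mapE x : zquot_map (zproj S x) = zproj T (f x).
Proof.
apply/zprojP; rewrite -raddfB; apply: zspan_map.
by apply/zprojP; rewrite zproj_repr.
Qed.

Lemma zquot_map_zmod_morphism : zmod_morphism zquot_map.
Proof.
move=> x y; rewrite -[x]zproj_repr -[y]zproj_repr -zprojB !zquot_mapE raddfB.
exact: zprojB.
Qed.

Definition zquot_additive : {additive zquot S -> zquot T} := HB.pack zquot_map
  (GRing.isZmodMorphism.Build (zquot S) (zquot T) zquot_map zquot_map_zmod_morphism).

Lemma zquot_additiveE x : zquot_additive (zproj S x) = zproj T (f x).
Proof. exact: zquot_mapE. Qed.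

End ZquotMap.

Section Freeg.
Variables (K : choiceType) (M : lmodType int) (f : K -> M).

HB.instance Definition _ := GRing.isZmodMorphism.Build {freeg K} M (fglift f)
  (lift_is_additive f).

End Freeg.

Lemma freeg_additive_eq (K : choiceType) (W : zmodType) (f g : {additive {freeg K} -> W}) :
  (forall x, f << x >> = g << x >>) -> f =1 g.
Proof.
move=> fg r; rewrite -(freeg_sumE r) !raddf_sum; apply: eq_bigr => x _.
by rewrite -[coeff x r]intz -freegU_mulz !raddfMz fg.
Qed.

(** * Diagrams with a constant label *)
Section SetLabel.
Variables (L L' : choiceType) (l : L) (l' : L').
Implicit Types D E : gauss L.

Definition with_label (a : arrow L) : arrow L' := (a.1, l').

Definition end_with_label (x : endpoint L) : endpoint L' := (with_label x.1, x.2).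

Definition labelled D := all (fun a => lab a == l) (arrows D).

Fact no_arrow_subproof : gauss_word ([::] : seq (endpoint L')). Proof. by []. Qed.

(** Meaningful for diagrams with constant label only: two arrows that differ by
    their labels alone would be identified. *)
Definition set_label D : gauss L' := insubd (Gauss no_arrow_subproof) (map end_with_label D).

Lemma with_label_inj D : labelled D -> {in arrows D &, injective with_label}.
Proof.
move=> /allP lD [a i] [c j] /lD/eqP /= ia /lD/eqP /= ja [ac].
by move: ia ja; rewrite /lab /= => -> ->; rewrite ac.
Qed.

Lemma gword_set_label D : labelled D -> gword (set_label D) = map end_with_label D.
Proof.
move=> lD; rewrite -[gword _]/(val _) insubdK //.
case: D lD => w gw lD; have /andP[uw /allP aw] := gw; apply/andP; split.
  rewrite map_inj_in_uniq // => -[x e] [y f] xw yw [xy ef].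
  have -> : x = y; last by rewrite ef.
  apply: (with_label_inj lD); rewrite /with_label ?xy //.
    exact: (mem_arrows (D := Gauss gw) xw).
  exact: (mem_arrows (D := Gauss gw) yw).
apply/allP => _ /mapP[x xw ->]; apply/mapP; exists (x.1, ~~ x.2) => //; exact: aw.
Qed.

Lemma arrows_set_label D : labelled D -> arrows (set_label D) = map with_label (arrows D).
Proof.
move=> lD; rewrite /arrows gword_set_label // filter_map -!map_comp.
by apply: eq_map => x.
Qed.

Lemma labelled_perm D E : gword D =i gword E -> labelled D = labelled E.
Proof.
move=> DE; apply: eq_all_r => a; apply/idP/idP => /(arrows_mem true).
  by rewrite DE; apply: (mem_arrows (D := E)).
by rewrite -DE; apply: (mem_arrows (D := D)).
Qed.

Lemma mem_gdel D a x : (x \in gword (gdel D a)) = (x.1 != a) && (x \in gword D).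
Proof. by rewrite mem_filter. Qed.

Lemma labelled_gdel D a : labelled D -> labelled (gdel D a).
Proof.
move=> /allP lD; apply/allP => c /(arrows_mem true); rewrite mem_gdel => /andP[_ cD].
exact/lD/(mem_arrows cD).
Qed.

Lemma labelled_giso b D E : giso b D E -> labelled D = labelled E.
Proof.
suff H D0 E0 : giso b D0 E0 -> labelled D0 -> labelled E0.
  by move=> DE; apply/idP/idP; apply: H; rewrite // giso_sym.
move=> /asboolP[g [_ gs [k _ E0E]]] /allP lD; apply/allP => a /(arrows_mem true).
rewrite E0E mem_rot => /mapP[x xD [-> _]].
by have xa := mem_arrows xD; rewrite (gs _ xa).2; apply: lD.
Qed.

Lemma set_label_gdel D a : labelled D -> a \in arrows D ->
  set_label (gdel D a) = gdel (set_label D) (with_label a).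
Proof.
move=> lD aD; apply/val_inj; rewrite /= -![val _]/(gword _) gword_set_label ?labelled_gdel //=.
rewrite gword_set_label // filter_map; congr map; apply: eq_in_filter => x xD /=.
by rewrite (inj_in_eq (with_label_inj lD)) // (mem_arrows xD).
Qed.

Lemma isolated_set_label D a : labelled D -> isolated D a -> isolated (set_label D) (with_label a).
Proof.
move=> lD [u [v [e DE]]]; exists (map end_with_label u), (map end_with_label v), e.
by rewrite gword_set_label // DE map_cat.
Qed.

Lemma bigon_set_label D a c : labelled D -> bigon D a c ->
  bigon (set_label D) (with_label a) (with_label c).
Proof.
move=> lD [sac [u [v [w [s1 [s2 [e [p1 p2 DE]]]]]]]]; split=> //.
exists (map end_with_label u), (map end_with_label v), (map end_with_label w).
exists (map end_with_label s1), (map end_with_label s2), e; split.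
- exact: (perm_map end_with_label p1).
- exact: (perm_map end_with_label p2).
by rewrite gword_set_label // DE !map_cat.
Qed.

Lemma omega3_labelled D E a1 a2 a3 : omega3 D E a1 a2 a3 -> labelled D = labelled E.
Proof.
move=> [_ _ [u0 [u1 [u2 [u3 [s1 [s2 [s3 [_ DE EE]]]]]]]]]; apply: labelled_perm => x.
by rewrite DE EE !mem_cat !mem_rev.
Qed.

Lemma omega3_set_label D E a1 a2 a3 : labelled D -> omega3 D E a1 a2 a3 ->
  omega3 (set_label D) (set_label E) (with_label a1) (with_label a2) (with_label a3).
Proof.
move=> lD o3; have lE : labelled E by rewrite -(omega3_labelled o3).
case: o3 => s12 s23 [u0 [u1 [u2 [u3 [s1 [s2 [s3 [p DE EE]]]]]]]]; split=> //.
pose F := map end_with_label.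
exists (F u0), (F u1), (F u2), (F u3), (F s1), (F s2), (F s3); split.
- exact: (perm_map F p).
- by rewrite gword_set_label // DE !map_cat.
by rewrite gword_set_label // EE !map_cat /F !map_rev.
Qed.

Lemma omega3_arrows D E a1 a2 a3 : omega3 D E a1 a2 a3 ->
  [/\ a1 \in arrows D, a2 \in arrows D & a3 \in arrows D] /\
  [/\ a1 \in arrows E, a2 \in arrows E & a3 \in arrows E].
Proof.
move=> [_ _ [u0 [u1 [u2 [u3 [s1 [s2 [s3 [p DE EE]]]]]]]]].
have fp : flatten [:: s1; s2; s3] =i
    [:: (a1, false); (a2, false); (a1, true); (a3, false); (a2, true); (a3, true)].
  by apply: perm_mem; apply: perm_trans (perm_flatten p) _.
have mD x : x \in flatten [:: s1; s2; s3] -> x \in gword D /\ x \in gword E.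
  rewrite DE EE /= !mem_cat !mem_rev in_nil orbF.
  by case/or3P => ->; rewrite ?orbT.
have m1 : (a1, false) \in flatten [:: s1; s2; s3] by rewrite fp !inE eqxx ?orbT.
have m2 : (a2, false) \in flatten [:: s1; s2; s3] by rewrite fp !inE eqxx ?orbT.
have m3 : (a3, false) \in flatten [:: s1; s2; s3] by rewrite fp !inE eqxx ?orbT.
have [[d1 e1] [d2 e2] [d3 e3]] := And3 (mD _ m1) (mD _ m2) (mD _ m3).
split; split.
- exact: (mem_arrows d1).
- exact: (mem_arrows d2).
- exact: (mem_arrows d3).
- exact: (mem_arrows e1).
- exact: (mem_arrows e2).
exact: (mem_arrows e3).
Qed.

Lemma omega3_neq D E a1 a2 a3 : omega3 D E a1 a2 a3 -> [/\ a1 != a2, a1 != a3 & a2 != a3].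
Proof.
move=> [_ _ [u0 [u1 [u2 [u3 [s1 [s2 [s3 [p DE _]]]]]]]]].
have uD : uniq (gword D) by case: (D) => w /= /andP[].
have : uniq (flatten [:: s1; s2; s3]).
  apply: subseq_uniq uD; rewrite DE /= cats0.
  apply: subseq_trans (suffix_subseq u0 _).
  apply: cat_subseq => //; apply: subseq_trans (suffix_subseq u1 _).
  apply: cat_subseq => //; apply: subseq_trans (suffix_subseq u2 _).
  exact: prefix_subseq.
rewrite (perm_uniq (perm_flatten p)) /= !inE !xpair_eqE !andbF !andbT /= !orbF.
by rewrite negb_or => /and3P[/andP[n1 n2] n3 _]; split.
Qed.

Lemma bigon_arrows D a c : bigon D a c -> [/\ a \in arrows D, c \in arrows D & a != c].
Proof.
move=> [sac [u [v [w [s1 [s2 [e [p1 _ DE]]]]]]]]; split.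
- by apply: (mem_arrows (x := (a, e))); rewrite DE !mem_cat (perm_mem p1) inE eqxx orbT.
- by apply: (mem_arrows (x := (c, e))); rewrite DE !mem_cat (perm_mem p1) !inE eqxx !orbT.
by apply: contraNneq sac => ->.
Qed.

End SetLabel.

Lemma clsP (L : choiceType) b (D E : gauss L) : cls b D = cls b E <-> giso b D E.
Proof. by split=> [/eqmodP|h]; [|apply/eqmodP]. Qed.

Lemma giso_repr (L : choiceType) b (D : gauss L) : giso b (repr (cls b D)) D.
Proof. by apply/clsP; rewrite /cls reprK. Qed.

Section RoundTrip.
Variables (L L' : choiceType) (l : L) (l' : L').
Implicit Types D E : gauss L.

Lemma labelled_set_label D : labelled l D -> labelled l' (set_label l' D).
Proof.
move=> lD; apply/allP => a; rewrite (arrows_set_label _ lD) => /mapP[c _ ->].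
exact: eqxx.
Qed.

Lemma set_labelK D : labelled l D -> set_label l (set_label l' D) = D.
Proof.
move=> lD; apply/val_inj; rewrite /= -![val _]/(gword _).
rewrite (gword_set_label l (labelled_set_label lD)) (gword_set_label l' lD).
rewrite -map_comp -[RHS]map_id; apply/eq_in_map => -[[a i] e] /mem_arrows /(allP lD) /eqP <-.
by [].
Qed.

Lemma giso_set_label b D E : labelled l D -> giso b D E -> giso b (set_label l' D) (set_label l' E).
Proof.
move=> lD DE; have lE : labelled l E by rewrite -(labelled_giso l DE).
move/asboolP: DE => [g [gi gs [k kb EE]]]; apply/asboolP.
have K a : a \in arrows D -> with_label l (with_label l' a) = a.
  by move=> /(allP lD)/eqP <-; case: a.
have gE a : a \in arrows D -> g a \in arrows E.
  move=> aD; apply: (mem_arrows (x := (g a, false))).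
  by rewrite EE mem_rot; apply/mapP; exists (a, false) => //; apply: arrows_mem.
exists (fun a => with_label l' (g (with_label l a))); split.
- move=> a c; rewrite (arrows_set_label l' lD) => /mapP[x xD ->] /mapP[y yD ->].
  rewrite !K // => /(with_label_inj lE) -/(_ (gE _ xD) (gE _ yD)) /gi.
  by move=> /(_ xD yD) ->.
- move=> a; rewrite (arrows_set_label l' lD) => /mapP[x xD ->].
  by rewrite K //; split=> //; apply: (gs _ xD).1.
exists k => //; rewrite (gword_set_label l' lE) (gword_set_label l' lD) EE map_rot.
congr rot; rewrite -!map_comp; apply/eq_in_map => -[a e] /mem_arrows /= aD.
by rewrite /end_with_label /mape /= K.
Qed.

End RoundTrip.

Section Transfer.
Variables (b : base) (L L' : choiceType) (l : L) (l' : L').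
Implicit Types D E : gauss L.

(** Diagrams with an arrow whose label is not [l] are sent to zero. *)
Definition relabelled (d : diagram L b) : {freeg (diagram L' b)} :=
  if labelled l (repr d) then << cls b (set_label l' (repr d)) >> else 0.

Definition relabel_map : {freeg (diagram L b)} -> {freeg (diagram L' b)} := fglift relabelled.

HB.instance Definition _ := GRing.isZmodMorphism.Build _ _ relabel_map (lift_is_additive relabelled).

Lemma relabel_map_gen D :
  relabel_map (gen b D) = if labelled l D then gen b (set_label l' D) else 0.
Proof.
rewrite /relabel_map /gen liftU scale1r /relabelled (labelled_giso l (giso_repr b D)).
case: ifP => // lD; congr << _ >>; apply/clsP; apply: (@giso_set_label _ _ l) (giso_repr b D).
by rewrite (labelled_giso l (giso_repr b D)).
Qed.

Lemma relabel_map_relation (lab1 : pred L) (lab3 : L -> L -> L -> bool)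
    (lab1' : pred L') (lab3' : L' -> L' -> L' -> bool) t (r : {freeg (diagram L b)}) :
  lab1' l' -> lab3' l' l' l' ->
  arrow_relation lab1 lab3 t (labelled l) r ->
  arrow_relation lab1' lab3' t (labelled l' : pred (gauss L')) (relabel_map r).
Proof.
move=> h1 h3; case=> [D a lD iso _|D a c lD big ac|D E a1 a2 a3 lD o3 _|D lD tD].
- rewrite relabel_map_gen lD; apply: Q1 (isolated_set_label l' lD iso) _ => //.
  exact: labelled_set_label lD.
- rewrite !raddfD /= !relabel_map_gen !labelled_gdel // lD.
  have [aD cD _] := bigon_arrows big.
  rewrite !(set_label_gdel (l := l)) //; apply: Q2 => //; first exact: labelled_set_label lD.
  exact: bigon_set_label lD big.
- rewrite raddfB !(raddfD relabel_map) /= !relabel_map_gen.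
  have lE : labelled l E by rewrite -(omega3_labelled l o3).
  have [[d1 d2 d3] [e1 e2 e3]] := omega3_arrows o3.
  rewrite !labelled_gdel // lD lE !(set_label_gdel (l := l)) //.
  apply: Q3 => //; first exact: labelled_set_label lD.
  exact: omega3_set_label lD o3.
rewrite relabel_map_gen lD; apply: At; first exact: labelled_set_label lD.
by rewrite (arrows_set_label l' lD) size_map.
Qed.

End Transfer.

Lemma arrow_relation_sub b (L : choiceType) lab1 lab3 t (G G' : pred (gauss L)) r :
  (forall D, G D -> G' D) -> @arrow_relation b L lab1 lab3 t G r -> arrow_relation lab1 lab3 t G' r.
Proof.
move=> GG' [D a|D a c|D E a1 a2 a3|D] /GG'.
- exact: Q1.
- exact: Q2.
- exact: Q3.
exact: At.
Qed.

(** * The retraction to the Polyak group *)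
Section Forget.
Variables (b : base) (m : enat) (t : nat).
Notation A := (diagram (label m) b).
Notation top := (ltop m).

Lemma unit_labelled (D : gauss unit) : labelled tt D.
Proof. by apply/allP => -[a []]. Qed.

Notation polyak_rel := (@arrow_relation b unit predT (fun _ _ _ => true) t predT).

Definition forget_map := relabel_map (b := b) top tt.
Definition top_map := relabel_map (b := b) tt top.

Lemma label_le_top (i : label m) : ele (val i) (val top).
Proof. by case: i => i /= /andP[]. Qed.

(** In a permitted triangle with different labels one label exceeds two equal
    ones, and these are then below the top. *)
Lemma two_below_top (i j k : label m) : lab3_ok i j k -> ~~ [&& istop i, istop j & istop k] ->
  [|| ~~ istop i && ~~ istop j, ~~ istop i && ~~ istop k | ~~ istop j && ~~ istop k].
Proof.
have lt (x y : label m) : elt (val x) (val y) -> ~~ istop x.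
  by apply: contraL => /eqP ->; rewrite negbK label_le_top.
rewrite /lab3_ok => /or4P[]; last by move=> ->.
- by case/andP => /lt nj /eqP <- _; rewrite nj !orbT.
- by case/andP => /lt ni /eqP <- _; rewrite ni !orbT.
by case/andP => /lt ni /eqP <- _; rewrite ni.
Qed.

(** A relation between diagrams at the top label becomes the corresponding
    relation without labels.  In the other relations all terms have an arrow
    below the top and are sent to zero: the arrows that may be deleted are at the
    top, or two of those involved are below it, and at most one of these is
    deleted. *)
Lemma forget_X_rel r : X_rel t r -> zspan polyak_rel (forget_map r).
Proof.
have from_top s : arrow_relation (@istop m) (@lab3_ok m) t (labelled top) s ->
    zspan polyak_rel (forget_map s).
  move=> /(relabel_map_relation (l' := tt) (lab1' := predT) (lab3' := fun _ _ _ => true) isT isT).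
  by move=> h; apply/zspan_gen; apply: arrow_relation_sub h.
have notop (D : gauss (label m)) a : a \in arrows D -> ~~ istop (lab a) -> labelled top D = false.
  by move=> aD; apply: contraNF => /allP /(_ _ aD).
have notop' (D : gauss (label m)) a c : a \in arrows D -> ~~ istop (lab a) -> a != c ->
    labelled top (gdel D c) = false.
  move=> aD na ac; apply: (notop _ a) na; apply: (mem_arrows (x := (a, true))).
  by rewrite mem_gdel ac arrows_mem.
case=> [D a _ iso ta|D a c _ big ac|D E a1 a2 a3 _ o3 ok|D _ tD].
- have [lD|lD] := boolP (labelled top D); first by apply: from_top; apply: Q1 iso ta.
  by rewrite /forget_map relabel_map_gen (negbTE lD); apply: zspan0.
- have [lD|lD] := boolP (labelled top D); first by apply: from_top; apply: Q2 big ac.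
  have [aD cD nac] := bigon_arrows big.
  have [ta|ta] := boolP (istop (lab a)); last first.
    rewrite /forget_map !raddfD /= !relabel_map_gen (notop _ a) // (notop' _ c a) ?(notop' _ a c) //.
    + by rewrite !addr0; apply: zspan0.
    + by rewrite -ac.
    by rewrite eq_sym.
  have del x : istop (lab x) -> labelled top (gdel D x) = false.
    move=> tx; apply: contraNF lD => /allP lx; apply/allP => y yD.
    have [->//|yx] := eqVneq y x; apply: lx; apply: (mem_arrows (x := (y, true))).
    by rewrite mem_gdel yx arrows_mem.
  rewrite /forget_map !raddfD /= !relabel_map_gen (negbTE lD) !del // -?ac //.
  by rewrite !addr0; apply: zspan0.
- have [lD|lD] := boolP (labelled top D); first by apply: from_top; apply: Q3 o3 ok.
  have lE : labelled top E = false by rewrite -(omega3_labelled top o3) (negbTE lD).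
  have [[d1 d2 d3] [e1 e2 e3]] := omega3_arrows o3.
  have [n12 n13 n23] := omega3_neq o3; rewrite /forget_map raddfB !(raddfD (relabel_map _ _)) /= !relabel_map_gen.
  have [ttt|ttt] := boolP [&& istop (lab a1), istop (lab a2) & istop (lab a3)].
    have del (F : gauss (label m)) x : labelled top F = false -> istop (lab x) ->
        labelled top (gdel F x) = false.
      move=> lF tx; apply: contraFF lF => /allP lx; apply/allP => y yD.
      have [->//|yx] := eqVneq y x; apply: lx; apply: (mem_arrows (x := (y, true))).
      by rewrite mem_gdel yx arrows_mem.
    case/and3P: ttt => t1 t2 t3.
    by rewrite (negbTE lD) lE !del ?(negbTE lD) // !addr0 subr0; apply: zspan0.
  have two (F : gauss (label m)) : labelled top F = false ->
      a1 \in arrows F -> a2 \in arrows F -> a3 \in arrows F ->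
      [/\ labelled top (gdel F a1) = false, labelled top (gdel F a2) = false
        & labelled top (gdel F a3) = false].
    move=> _ f1 f2 f3; have [n21 n31 n32] : [/\ a2 != a1, a3 != a1 & a3 != a2].
      by split; rewrite eq_sym.
    have kill a c : a \in arrows F -> ~~ istop (lab a) -> a != c ->
      labelled top (gdel F c) = false by exact: notop'.
    case/or3P: (two_below_top ok ttt) => /andP[u v].
    + by split; [apply: (kill a2)|apply: (kill a1)|apply: (kill a1)].
    + by split; [apply: (kill a3)|apply: (kill a1)|apply: (kill a1)].
    by split; [apply: (kill a2)|apply: (kill a3)|apply: (kill a2)].
  have [-> -> ->] := two D (negbTE lD) d1 d2 d3; have [-> -> ->] := two E lE e1 e2 e3.
  by rewrite (negbTE lD) lE !addr0 subr0; apply: zspan0.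
have [lD|lD] := boolP (labelled top D); first by apply: from_top; apply: At.
by rewrite /forget_map relabel_map_gen (negbTE lD); apply: zspan0.
Qed.

End Forget.

Section Isomorphism.
Variables (b : base) (m : enat) (t : nat).
Notation A := (diagram (label m) b).
Notation top := (ltop m).
Notation forget_map := (@forget_map b m).
Notation top_map := (@top_map b m).

HB.instance Definition _ := GRing.isZmodMorphism.Build {freeg (Ediag b m)} {freeg A}
  (@Eincl b m) (lift_is_additive _).

Lemma repr_set_top (d : diagram unit b) :
  alltop (repr (cls b (set_label top (repr d)))).
Proof.
rewrite -[alltop _]/(labelled top _) (labelled_giso top (giso_repr b _)).
exact: labelled_set_label (unit_labelled _).
Qed.

Definition top_diagram (d : diagram unit b) : Ediag b m :=
  exist (fun x : A => is_true (alltop (repr x))) _ (repr_set_top d).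

Definition top_lift : {freeg (diagram unit b)} -> {freeg (Ediag b m)} :=
  fglift (fun d => << top_diagram d >> : {freeg (Ediag b m)}).

HB.instance Definition _ := GRing.isZmodMorphism.Build _ _ top_lift (lift_is_additive _).

Lemma EinclU (d : Ediag b m) : Eincl << d >> = << val d >>.
Proof. by rewrite /Eincl liftU scale1r. Qed.

Lemma top_liftU d : top_lift << d >> = << top_diagram d >>.
Proof. by rewrite /top_lift liftU scale1r. Qed.

Lemma Eincl_top_lift r : Eincl (top_lift r) = top_map r.
Proof.
apply: (@freeg_additive_eq _ _ (@Eincl b m \o top_lift) (relabel_map (b := b) tt top)) => d /=.
rewrite top_liftU EinclU /= /relabel_map liftU scale1r /relabelled.
by rewrite unit_labelled.
Qed.

Lemma forget_top_map r : forget_map (top_map r) = r.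
Proof.
apply: (@freeg_additive_eq _ _ (relabel_map (b := b) top tt \o relabel_map (b := b) tt top) idfun) => d /=.
rewrite -[d]reprK -/(cls b _) -/(gen b (repr d)) !relabel_map_gen unit_labelled relabel_map_gen.
rewrite (labelled_set_label top (unit_labelled _)) /gen; congr << _ >>; congr cls.
exact: (set_labelK top (unit_labelled (repr d))).
Qed.

Lemma top_lift_forget r : top_lift (forget_map (Eincl r)) = r.
Proof.
apply: (@freeg_additive_eq _ _ (top_lift \o (relabel_map (b := b) top tt \o @Eincl b m)) idfun) => d /=.
rewrite EinclU; case: d => d dtop /=.
have -> : << d >> = gen b (repr d) by rewrite /gen /cls reprK.
rewrite relabel_map_gen -[labelled top _]/(alltop (repr d)) dtop /gen top_liftU.
congr << _ >>; apply: val_inj => /=; rewrite -[RHS]reprK; apply/clsP.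
rewrite -[X in giso b _ X](set_labelK tt (l := top)) //.
apply: (giso_set_label _ (l := tt)); first exact: unit_labelled.
exact: giso_repr.
Qed.

Notation polyak_rel := (@arrow_relation b unit predT (fun _ _ _ => true) t predT).

Lemma E_rel_X r : E_rel t r -> zspan (@X_rel b m t) (Eincl r).
Proof. by move=> h; apply/zspan_gen; apply: arrow_relation_sub h. Qed.

Lemma E_rel_polyak r : E_rel t r -> zspan polyak_rel (forget_map (Eincl r)).
Proof.
by move=> h; apply: (@forget_X_rel b m t); apply: arrow_relation_sub h.
Qed.

Lemma polyak_E_rel r : polyak_rel r -> zspan (@E_rel b m t) (top_lift r).
Proof.
move=> h; apply: zspan_gen; rewrite /E_rel Eincl_top_lift.
apply: (relabel_map_relation (l := tt) (l' := top) (lab1' := @istop m) (lab3' := @lab3_ok m)).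
- exact: eqxx.
- by rewrite /lab3_ok /istop !eqxx !orbT.
by apply: arrow_relation_sub h => D _; apply: unit_labelled.
Qed.

Definition E_to_polyak : {additive Egrp b m t -> Polyak b t} :=
  @zquot_additive _ _ _ _ (relabel_map (b := b) top tt \o @Eincl b m) E_rel_polyak.

Definition polyak_to_E : {additive Polyak b t -> Egrp b m t} :=
  @zquot_additive _ _ _ _ top_lift polyak_E_rel.

Definition E_to_X : {additive Egrp b m t -> Xgrp b m t} :=
  @zquot_additive _ _ _ _ (@Eincl b m) E_rel_X.

Definition X_to_polyak : {additive Xgrp b m t -> Polyak b t} :=
  @zquot_additive _ _ _ _ (relabel_map (b := b) top tt) (@forget_X_rel b m t).

Lemma E_to_polyakE r : E_to_polyak (Eproj t r) = zproj _ (forget_map (Eincl r)).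
Proof. exact: zquot_additiveE. Qed.

Lemma polyak_to_EE r : polyak_to_E (zproj _ r) = Eproj t (top_lift r).
Proof. exact: zquot_additiveE. Qed.

Lemma E_to_XE r : E_to_X (Eproj t r) = Xproj t (Eincl r).
Proof. exact: zquot_additiveE. Qed.

Lemma X_to_polyakE r : X_to_polyak (Xproj t r) = zproj _ (forget_map r).
Proof. exact: zquot_additiveE. Qed.

Lemma E_to_polyakK : cancel E_to_polyak polyak_to_E.
Proof.
move=> x; rewrite -(zproj_repr x); move: (repr x) => r.
by rewrite E_to_polyakE polyak_to_EE top_lift_forget.
Qed.

Lemma polyak_to_EK : cancel polyak_to_E E_to_polyak.
Proof.
move=> x; rewrite -(zproj_repr x); move: (repr x) => r.
by rewrite polyak_to_EE E_to_polyakE Eincl_top_lift forget_top_map.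
Qed.

(** Since [E_to_polyak] is bijective, this is a retraction of the inclusion. *)
Lemma X_to_polyak_E x : X_to_polyak (E_to_X x) = E_to_polyak x.
Proof.
rewrite -(zproj_repr x); move: (repr x) => r.
by rewrite E_to_XE X_to_polyakE -E_to_polyakE.
Qed.

Lemma E_to_X_inj : injective E_to_X.
Proof.
by move=> x y /(congr1 X_to_polyak); rewrite !X_to_polyak_E; apply: (can_inj E_to_polyakK).
Qed.

Lemma gen_alltop (D : gauss (label m)) : alltop D -> exists d : Ediag b m, Eincl << d >> = gen b D.
Proof.
move=> lD; have h : alltop (repr (cls b D)).
  by rewrite -[alltop _]/(labelled top _) (labelled_giso top (giso_repr b D)).
by exists (exist (fun x : A => is_true (alltop (repr x))) _ h); rewrite EinclU.
Qed.

Section EvenDiagrams.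
Variable P : gauss unit -> arrow unit -> bool.

(** Without odd arrows the diagram is fixed by the deletion of odd arrows, and no
    arrow is ever deleted. *)
Lemma fm_label_even (D : gauss unit) x :
  {in arrows D, forall y, P D y = false} -> x \in arrows D -> fm_label P m D x = top.
Proof.
move=> even xD; have fD : fpar P D = D.
  apply/val_inj; rewrite /= -[val _]/(gword _) /=; apply/all_filterP/allP => y yD.
  by rewrite even // (mem_arrows yD).
apply/val_inj; rewrite /= /fm_val; case: pselect => // ex; exfalso; case: ex => i /and3P[_ _].
have -> : iter i (fpar P) D = D by elim: i => //= i ->.
by rewrite xD.
Qed.

(** Subdiagrams of a diagram at the top label are at the top label. *)
Lemma Isub_Lambda_even (d : diagram unit b) :
  {in arrows (repr d), forall y, P (repr d) y = false} ->
  exists r, Eincl r = Isub (Lambda m P << d >>).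
Proof.
move=> even; rewrite /Lambda liftU scale1r /Isub liftU scale1r.
set D := relabel _ _; have lD : labelled top D.
  apply/allP => a aD; have /mapP[x xd [-> _]] := arrows_mem true aD.
  by rewrite /lab /= fm_label_even // (mem_arrows xd).
have lF : labelled top (repr (cls b D)) by rewrite (labelled_giso top (giso_repr b D)).
have big F : exists r, Eincl r = gen b (gkeep (fun a => a \in F) (repr (cls b D))) :> {freeg A}.
  have [|r] := @gen_alltop (gkeep (fun a => a \in F) (repr (cls b D))); last by exists << r >>.
  apply/allP => a /(arrows_mem true); rewrite mem_filter => /andP[_ /mem_arrows].
  exact: (allP lF).
elim/big_ind: _ => [|x y [r <-] [r' <-]|F _]; last exact: big.
  by exists 0; rewrite raddf0.
by exists (r + r'); rewrite raddfD.
Qed.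

End EvenDiagrams.
End Isomorphism.

Theorem theorem6 (R : realType) (b : base) (P : gauss unit -> arrow unit -> bool)
    (m : enat) (t : nat) :
  parity b P ->
  (exists f : {additive Egrp b m t -> Polyak b t}, bijective f) /\
  (exists iota : {additive Egrp b m t -> Xgrp b m t},
    [/\ forall r : {freeg (Ediag b m)}, iota (Eproj t r) = Xproj t (Eincl r),
        forall x, iota x = 0 <-> x = 0 &
        forall v w : {additive Xgrp b m t -> rat},
          (forall x, v (iota x) = w (iota x)) ->
          forall d : diagram unit b, classical R d ->
            v (Xproj t (Isub (Lambda m P << d >>))) =
            w (Xproj t (Isub (Lambda m P << d >>)))]).
Proof.
move=> parP; split.
  exists (E_to_polyak b m t); exists (polyak_to_E b m t); first exact: E_to_polyakK.
  exact: polyak_to_EK.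
exists (E_to_X b m t); split.
- exact: E_to_XE.
- move=> x; split=> [|->]; last by rewrite raddf0.
  by rewrite -[0 in X in X -> _](raddf0 (E_to_X b m t)) => /E_to_X_inj.
move=> v w vw d [K [D [dK KD dE]]].
have even : {in arrows (repr d), forall y, P (repr d) y = false}.
  have /asboolP[g gD] : giso b (repr d) D by rewrite dE giso_repr.
  move=> y yd; rewrite -(parity_iso parP gD) //.
  apply: (even_of_knot dK parP KD).
  case: gD => _ _ [k _ DE]; apply: (mem_arrows (x := (g y, false))).
  by rewrite DE mem_rot; apply/mapP; exists (y, false) => //; apply: arrows_mem.
have [r <-] := Isub_Lambda_even m even.
by rewrite -E_to_XE.
Qed.
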